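(* Let $X$ be a finite-dimensional real or complex inner product space (Hermitian in the complex case). For any blades $A,B\in\bigwedge X$, $$\|A\wedge B\|=\|A\|\|B\|\cos\Theta^\perp_{[A],[B]}.$$
   Context: $X$ is real Euclidean or complex with Hermitian product $\langle\cdot,\cdot\rangle$, conjugate-linear in the first argument. $\bigwedge X$ has the induced inner product ($\langle v_1\wedge\cdots\wedge v_p,w_1\wedge\cdots\wedge w_p\rangle=\det(\langle v_i,w_j\rangle)$, different grades being orthogonal) and norm $\|\cdot\|$. A $p$-blade ($p\ge1$) is $A=v_1\wedge\cdots\wedge v_p$; if $A\neq0$, $[A]=\mathrm{span}(v_1,\ldots,v_p)$. Scalars are $0$-blades with $[A]=\{0\}$; $[0]=\{0\}$. Angles: for subspaces $V,W$, let $k$ be the real dimension of $V$ (i.e. $k=\dim V$ in the real case, $k=2\dim_{\mathbb C}V$ in the complex case), $P_W$ the orthogonal projection onto $W$, $S\subset V$ a non-degenerate $k$-dimensional parallelotope, and $\pi_{V,W}=\frac{\mathrm{vol}_k(P_W(S))}{\mathrm{vol}_k(S)}$ ($\mathrm{vol}_0$ of a point is $1$). The asymmetric angle $\Theta_{V,W}\in[0,\frac\pi2]$ is given by $\cos\Theta_{V,W}=\pi_{V,W}$ in the real case, and $\cos^2\Theta_{V,W}=\pi_{V,W}$ in the complex case. The complementary angle is $\Theta^\perp_{V,W}=\Theta_{V,W^\perp}$, where $W^\perp$ is the orthogonal complement of $W$. *)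

(* Defs.v *)
From HB Require Import structures.
From mathcomp Require Import all_boot all_order all_algebra.
From mathcomp Require Import complex.
From mathcomp Require Import all_classical all_reals all_analysis.

Set Implicit Arguments.
Unset Strict Implicit.
Unset Printing Implicit Defensive.

Import Order.TTheory GRing.Theory Num.Theory.
Import numFieldNormedType.Exports.

Local Open Scope classical_set_scope.
Local Open Scope ring_scope.

Variant ground := Reals | Complexes.

Section Ground.
Variable R : realType.

Definition ground_field (K : ground) : numFieldType :=
  match K with Reals => R | Complexes => R[i] end.

Definition sconj (K : ground) : involutive_rmorphism (ground_field K) :=
  match K with
  | Reals => (idfun : involutive_rmorphism R)
  | Complexes => (Num.conj : involutive_rmorphism R[i])
  end.

Definition of_real (K : ground) : R -> ground_field K :=
  match K with Reals => fun t => t | Complexes => fun t => t%:C%C end.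

Definition real_part (K : ground) : ground_field K -> R :=
  match K with Reals => fun z => z | Complexes => fun z => complex.Re z end.

Definition real_degree (K : ground) : nat :=
  match K with Reals => 1%N | Complexes => 2%N end.

(* n-dimensional Lebesgue measure: iterating the library's product measure,
   for which (m1 \x m2) E = \int[m1]_x m2 (xsection E x). *)
Fixpoint lebesgue_n (n : nat) : set (n.-tuple R) -> \bar R :=
  match n with
  | 0 => fun E => (\1_E [tuple])%:E
  | n'.+1 => fun E =>
      (\int[lebesgue_measure]_x lebesgue_n [set t | E (cons_tuple x t)])%E
  end.

End Ground.

(* The exterior algebra of X in coordinates: with e_0, ..., e_(n-1) the basis
   vbasis fullv of X, the multivector a stands for the sum over the subsets
   S = {i_1 < ... < i_p} of a S *: (e_(i_1) /\ ... /\ e_(i_p)). *)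
Section ExteriorAlgebra.
Variables (F : fieldType) (X : vectType F).
Local Notation n := (\dim (fullv : {vspace X})).

Definition multivector := {ffun {set 'I_n} -> F}.

Implicit Types (S T U : {set 'I_n}) (a b : multivector).

(* number of transpositions needed to sort the concatenation of S and T *)
Definition inversions S T : nat :=
  #|[set ij : 'I_n * 'I_n | [&& ij.1 \in S, ij.2 \in T & (ij.2 < ij.1)%N]]|.

Definition mv_wedge a b : multivector :=
  [ffun U : {set 'I_n} => \sum_(S : {set 'I_n} | S \subset U)
     (-1) ^+ inversions S (U :\: S) * a S * b (U :\: S)].

Definition mv_scalar (c : F) : multivector :=
  [ffun S : {set 'I_n} => if S == finset.set0 then c else 0].

Definition mv_vec (v : X) : multivector :=
  [ffun S : {set 'I_n} =>
     \sum_(i < n | S == [set i]%SET) coord (vbasis fullv) i v].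

Definition mv_wedges (vs : seq X) : multivector :=
  foldr (fun v => mv_wedge (mv_vec v)) (mv_scalar 1) vs.

Definition is_blade a : Prop :=
  (exists c : F, a = mv_scalar c) \/
  (exists vs : seq X, (0 < size vs)%N /\ a = mv_wedges vs).

(* [a]; the default value 0 is used for scalars and for the null blade *)
Definition blade_space a : {vspace X} :=
  xget 0%VS [set V : {vspace X} | a != 0 /\
    exists vs : seq X, [/\ (0 < size vs)%N, a = mv_wedges vs & V = <<vs>>%VS]].

End ExteriorAlgebra.

Section InnerProduct.
Variables (R : realType) (K : ground) (X : vectType (ground_field R K)).
Variable dot : {dot X for sconj R K}.
Local Notation n := (\dim (fullv : {vspace X})).

(* MathComp forms are conjugate-linear in their second argument *)
Definition ip (v w : X) : ground_field R K := dot w v.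

Definition gram_det (vs ws : seq X) : ground_field R K :=
  \det (\matrix_(i < size vs, j < size vs) ip vs`_i ws`_j).

Definition basis_vectors (S : {set 'I_n}) : seq X :=
  [seq (vbasis (fullv : {vspace X}))`_i | i : 'I_n <- enum S].

(* sesquilinear extension of <v_1 /\ ... /\ v_p, w_1 /\ ... /\ w_p> =
   det <v_i, w_j> from the basis blades *)
Definition mv_ip (a b : multivector X) : ground_field R K :=
  \sum_(S : {set 'I_n}) \sum_(T : {set 'I_n} | #|T| == #|S|)
    sconj R K (a S) * b T * gram_det (basis_vectors S) (basis_vectors T).

Definition mv_norm (a : multivector X) : R := Num.sqrt (real_part (mv_ip a a)).

Definition orth_compl (W : {vspace X}) : {vspace X} := orthov dot W.

Definition orth_proj (W : {vspace X}) (v : X) : X :=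
  daddv_pi W (orth_compl W) v.

Definition real_lincomb k (t : k.-tuple R) (u : k.-tuple X) : X :=
  \sum_(i < k) of_real K (tnth t i) *: tnth u i.

Definition real_orthonormal k (f : k.-tuple X) : Prop :=
  forall i j, real_part (ip (tnth f i) (tnth f j)) = (i == j)%:R.

Definition parallelotope k (o : X) (u : k.-tuple X) : set X :=
  [set x | exists t : k.-tuple R,
     (forall i, 0 <= tnth t i <= 1) /\ x = o + real_lincomb t u].

Definition real_free k (u : k.-tuple X) : Prop :=
  forall t : k.-tuple R, real_lincomb t u = 0 -> forall i, tnth t i = 0.

(* k-dimensional volume of a subset E of some k-dimensional real subspace of X:
   Lebesgue measure in the coordinates of an orthonormal basis f of such a
   subspace, for the Euclidean structure Re <., .> (the choice of f does not
   matter) *)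
Definition vol k (E : set X) : R :=
  let f := xget [tuple of nseq k 0] [set f : k.-tuple X |
     real_orthonormal f /\ E `<=` range (fun t => real_lincomb t f)] in
  fine (lebesgue_n [set t | E (real_lincomb t f)]).

Definition real_dim (V : {vspace X}) : nat := (real_degree K * \dim V)%N.

(* cos theta = pi_{V,W} in the real case, cos^2 theta = pi_{V,W} in the complex
   case; pi_{V,W} does not depend on the parallelotope *)
Definition is_asym_angle (V W : {vspace X}) (theta : R) : Prop :=
  0 <= theta <= pi / 2 /\
  forall (o : X) (u : (real_dim V).-tuple X),
    let S := parallelotope o u in
    real_free u -> S `<=` [set` V] ->
    cos theta ^+ real_degree K =
      vol (real_dim V) (orth_proj W @` S) / vol (real_dim V) S.

Definition asym_angle (V W : {vspace X}) : R := xget 0 (is_asym_angle V W).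

Definition compl_angle (V W : {vspace X}) : R := asym_angle V (orth_compl W).

End InnerProduct.

(* Main.v *)
From HB Require Import structures.
Require Import Defs.
From mathcomp Require Import all_boot all_order all_algebra.
From mathcomp Require Import perm complex.
From mathcomp Require Import all_classical all_reals all_analysis.
From mathcomp Require Import measurable_realfun.
From mathcomp Require Import ring lra.

(* The norm of a blade is governed by Gram determinants: by the Cauchy-Binet
   expansion, |v_1 /\ ... /\ v_p|^2 = det <v_i, v_j>. If A and B are the wedges
   of vs and ws and P is the orthogonal projection onto [B]^perp, replacing vs
   by P vs does not change A /\ B and makes the Gram matrix block diagonal, so
     |A /\ B|^2 = det Gram (P vs) * det Gram ws.
   In orthonormal bases of [A] and of a space of the same dimension containing
   P [A], P has a square matrix M and det Gram (P vs) = |det M|^2 det Gram vs.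
   The volume of a parallelotope is the square root of its real Gram
   determinant, hence P multiplies the volumes of parallelotopes of [A] by the
   absolute value of the determinant of M seen as a real matrix: |det M| in the
   real case, |det M|^2 in the complex case. So cos Theta = |det M|. *)

Set Implicit Arguments.
Unset Strict Implicit.
Unset Printing Implicit Defensive.

Import Order.TTheory GRing.Theory Num.Theory.
Import numFieldNormedType.Exports.

Local Open Scope classical_set_scope.
Local Open Scope ring_scope.

(** * Lebesgue measure on tuples and linear maps *)

Section IsoProduct.
Context d1 d2 d (T1 : measurableType d1) (T2 : measurableType d2)
  (T : measurableType d) (R : realType).
Variables (m1 : {sigma_finite_measure set T1 -> \bar R}).
Variables (m2 : {sigma_finite_measure set T2 -> \bar R}).
Variables (f : T1 * T2 -> T) (g : T -> T1 * T2).
Hypotheses (mf : measurable_fun setT f) (mg : measurable_fun setT g).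
Hypothesis (fK : cancel f g).

Definition iso_product (mf : measurable_fun setT f) (mg : measurable_fun setT g)
  (fK : cancel f g) := pushforward (m1 \x m2)%E f.
Local Notation p := (iso_product mf mg fK).

Let pm : {measure set T -> \bar R} :=
  measure_function_pushforward__canonical__measure_function_Measure
    (m1 \x m2)%E mf.

HB.instance Definition _ := isMeasure.Build _ _ _ p
  (measure0 pm) (measure_ge0 pm) (measure_semi_sigma_additive (s := pm)).

Let iso_product_sigma_finite : sigma_finite setT p.
Proof.
have /sigma_finiteP[F [FT _ Foo]] := isSigmaFinite.sigma_finiteT
  (lebesgue_integral_fubini.measure_function_Measure_isSigmaFinite__to__measure_function_isSigmaFinite
     m1 m2).
exists (fun k => g @^-1` F k).
  by rewrite -preimage_bigcup -FT preimage_setT.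
move=> k; have [mF Fk] := Foo k; split.
  by rewrite -[X in measurable X]setTI; exact: mg.
rewrite /iso_product /pushforward (_ : _ @^-1` _ = F k) //.
by apply/seteqP; split => x /=; rewrite fK.
Qed.

HB.instance Definition _ := Measure_isSigmaFinite.Build _ _ _ p
  iso_product_sigma_finite.

Lemma iso_product1 A : p A = (\int[m1]_x m2 [set t | A (f (x, t))])%E.
Proof.
apply: eq_integral => x _ /=; congr (m2 _).
by apply/seteqP; split => t /=; rewrite /xsection /= inE.
Qed.

Lemma iso_product2 A : measurable A ->
  p A = (\int[m2]_t m1 [set x | A (f (x, t))])%E.
Proof.
move=> mA; have mB : measurable (f @^-1` A).
  by rewrite -[X in measurable X]setTI; exact: mf.
rewrite /iso_product /pushforward.
rewrite (@product_measure_unique _ _ _ _ _ m1 m2 (m1 \x^ m2)%E) //.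
  apply: eq_integral => t _ /=; congr (m1 _).
  by apply/seteqP; split => x /=; rewrite /ysection /= inE.
by move=> X Y mX mY; exact: product_measure2E.
Qed.

Lemma iso_product_section A x : measurable A ->
  measurable [set t | A (f (x, t))].
Proof.
move=> mA; rewrite (_ : mkset _ = xsection (f @^-1` A) x); last first.
  by apply/seteqP; split => t /=; rewrite /xsection /= inE.
by apply: measurable_xsection; rewrite -[X in measurable X]setTI; exact: mf.
Qed.

Lemma iso_product_section_swap A t : measurable A ->
  measurable [set x | A (f (x, t))].
Proof.
move=> mA; rewrite (_ : mkset _ = ysection (f @^-1` A) t); last first.
  by apply/seteqP; split => x /=; rewrite /ysection /= inE.
by apply: measurable_ysection; rewrite -[X in measurable X]setTI; exact: mf.
Qed.

Lemma iso_product_fun A : measurable A ->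
  measurable_fun setT (m2 \o (fun x => [set t | A (f (x, t))]) : T1 -> \bar R).
Proof.
move=> mA; rewrite (_ : _ \o _ = m2 \o xsection (f @^-1` A)).
  apply: measurable_fun_xsection.
  by rewrite -[X in measurable X]setTI; exact: mf.
apply/funext => x /=; congr (m2 _).
by apply/seteqP; split => t /=; rewrite /xsection /= inE.
Qed.

Lemma iso_product_fun_swap A : measurable A ->
  measurable_fun setT (m1 \o (fun t => [set x | A (f (x, t))]) : T2 -> \bar R).
Proof.
move=> mA; rewrite (_ : _ \o _ = m1 \o ysection (f @^-1` A)).
  apply: measurable_fun_ysection.
  by rewrite -[X in measurable X]setTI; exact: mf.
apply/funext => t /=; congr (m1 _).
by apply/seteqP; split => x /=; rewrite /ysection /= inE.
Qed.

End IsoProduct.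

Section LebesgueMeasureTuple.
Variable R : realType.

Local Notation T n := (n.-tuple (measurableTypeR R)).
Local Notation leb1 := (@lebesgue_measure R).

Lemma lebesgue_n_ge0 n (A : set (n.-tuple R)) : (0 <= lebesgue_n A)%E.
Proof.
elim: n A => [A|n IH A] /=; first by rewrite lee_fin indicE.
by apply: integral_ge0 => x _; exact: IH.
Qed.

Lemma le_lebesgue_n n (A B : set (n.-tuple R)) :
  A `<=` B -> (lebesgue_n A <= lebesgue_n B)%E.
Proof.
elim: n A B => [|n IH] A B AB /=.
  rewrite lee_fin !indicE ler_nat.
  by case: (boolP ([tuple] \in A)) => // /set_mem/AB/mem_set ->.
(* No measurability is needed: the integral of a nonnegative function is the
   supremum of the integrals of the simple functions below it. *)
rewrite !ge0_integralTE; try by move=> x; exact: lebesgue_n_ge0.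
apply: ge_ereal_sup => _ [h /= hA <-]; apply: ereal_sup_ubound.
exists h => //= x; apply: (le_trans (hA x)); apply: IH => t; exact: AB.
Qed.

Definition tcons n (z : measurableTypeR R * T n) : T n.+1 := cons_tuple z.1 z.2.
Arguments tcons : simpl never.

Definition tuncons n (t : T n.+1) : measurableTypeR R * T n :=
  (thead t, [tuple of behead t]).

Lemma tconsK n : cancel (@tcons n) (@tuncons n).
Proof. by case=> x t; congr pair => //; apply: val_inj. Qed.

Lemma tunconsK n : cancel (@tuncons n) (@tcons n).
Proof. by move=> t; rewrite [t in RHS]tuple_eta; apply: val_inj. Qed.

Lemma measurable_tcons n : measurable_fun setT (@tcons n).
Proof. exact: measurable_cons. Qed.

Lemma measurable_tuncons n : measurable_fun setT (@tuncons n).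
Proof.
apply/measurable_fun_pair => /=; first exact: (measurable_tnth ord0).
exact: measurable_behead.
Qed.

Definition leb_next n (m : {sigma_finite_measure set (T n) -> \bar R}) :
  {sigma_finite_measure set (T n.+1) -> \bar R} :=
  iso_product leb1 m (@measurable_tcons n) (@measurable_tuncons n) (@tconsK n).

Fixpoint leb n : {sigma_finite_measure set (T n) -> \bar R} :=
  match n with
  | 0 => dirac ([tuple] : T 0)
  | n'.+1 => leb_next (leb n')
  end.

Lemma measurable_tcons_section n (A : set (T n.+1)) x :
  measurable A -> measurable [set t | A (tcons (x, t))].
Proof. by move=> mA; apply: (iso_product_section (@measurable_tcons n)). Qed.

Lemma measurable_tcons_section_swap n (A : set (T n.+1)) t :
  measurable A -> measurable [set x | A (tcons (x, t))].
Proof. by move=> mA; apply: (iso_product_section_swap (@measurable_tcons n)). Qed.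

Lemma measurable_leb_section n (A : set (T n.+1)) : measurable A ->
  measurable_fun setT
    (leb n \o (fun x => [set t | A (tcons (x, t))]) : _ -> \bar R).
Proof. by move=> mA; apply: (iso_product_fun (leb n) (@measurable_tcons n)). Qed.

Lemma measurable_leb_section_swap n (A : set (T n.+1)) : measurable A ->
  measurable_fun setT
    (leb1 \o (fun t => [set x | A (tcons (x, t))]) : _ -> \bar R).
Proof. by move=> mA; apply: (iso_product_fun_swap leb1 (@measurable_tcons n)). Qed.

Lemma lebS n (A : set (T n.+1)) :
  leb n.+1 A = (\int[leb1]_x leb n [set t | A (tcons (x, t))])%E.
Proof. exact: iso_product1. Qed.

Lemma lebS_swap n (A : set (T n.+1)) : measurable A ->
  leb n.+1 A = (\int[leb n]_t leb1 [set x | A (tcons (x, t))])%E.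
Proof. exact: iso_product2. Qed.

Lemma lebE n (A : set (T n)) : leb n A = lebesgue_n A.
Proof.
elim: n A => [//|n IH] A; rewrite lebS /=.
by apply: eq_integral => x _; rewrite IH.
Qed.

Lemma lebesgue_measure_affine (a b : R) (A : set (measurableTypeR R)) :
  a != 0 -> measurable A ->
  (`|a|%:E * leb1 [set x : R | A (a * x + b)%R])%E = leb1 A.
Proof.
move=> a0 mA; pose f (x : measurableTypeR R) : measurableTypeR R := a * x + b.
have mf : measurable_fun setT f.
  apply: measurable_funD => //; exact: measurable_funM.
pose p : {measure set (measurableTypeR R) -> \bar R} :=
  measure_function_pushforward__canonical__measure_function_Measure leb1 mf.
pose m : {measure set (measurableTypeR R) -> \bar R} :=
  mscale (NngNum (normr_ge0 a)) p.
rewrite -[LHS]/(m A); apply/esym/lebesgue_measure_unique => //.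
move=> _ [[c e] _ <-]; rewrite /= /mscale /= /pushforward /=.
have aV : `|a| * a^-1 = Num.sg a by rewrite normrEsg mulfK.
have [agt|alt] := ltP 0 a.
  rewrite (_ : f @^-1` _ = `](c - b) / a, (e - b) / a]%classic); last first.
    apply/seteqP; split => x /=; rewrite !in_itv /= ltr_pdivrMr // ler_pdivlMr //;
      rewrite /f [x * a]mulrC; lra.
  rewrite !lebesgue_measure_itv /= !lte_fin ltr_pM2r ?invr_gt0 // ltrD2r.
  case: ifP => _; last by rewrite mule0.
  by rewrite !EFinN -!EFinD -EFinM gtr0_norm //; congr EFin; field.
have {}alt : a < 0 by rewrite lt_neqAle a0.
rewrite (_ : f @^-1` _ = `[(e - b) / a, (c - b) / a[%classic); last first.
  apply/seteqP; split => x /=; rewrite !in_itv /= ltr_ndivlMr // ler_ndivrMr //;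
    rewrite /f [x * a]mulrC; lra.
rewrite !lebesgue_measure_itv /= !lte_fin ltr_nM2r ?invr_lt0 // ltrD2r.
case: ifP => _; last by rewrite mule0.
by rewrite !EFinN -!EFinD -EFinM ltr0_norm //; congr EFin; field.
Qed.

End LebesgueMeasureTuple.

Lemma det_schur (F : fieldType) n (M : 'M[F]_n.+1) : M ord0 ord0 != 0 ->
  \det M = M ord0 ord0 * \det (\matrix_(i < n, j < n)
    (M (lift ord0 i) (lift ord0 j) -
     M (lift ord0 i) ord0 / M ord0 ord0 * M ord0 (lift ord0 j))).
Proof.
set a := M ord0 ord0 => a0; set S := \matrix_(i, j) _.
pose C : 'cV[F]_n := \col_i (M (lift ord0 i) ord0 / a).
pose r : 'rV[F]_n := \row_j M ord0 (lift ord0 j).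
have -> : M = block_mx 1%:M 0 C 1%:M
  *m block_mx (a%:M : 'M[F]_1) r 0 S :> 'M[F]_(1 + n).
  rewrite mulmx_block !mul1mx !mul0mx !addr0 mul_mx_scalar.
  apply/matrixP => i j; rewrite !mxE.
  case: splitP => i' ii'; rewrite mxE; case: splitP => j' jj'; rewrite !mxE ?ord1.
  - rewrite eqxx mulr1n /a; congr (M _ _); apply: val_inj => /=.
      by rewrite ii' ord1.
    by rewrite jj' ord1.
  - congr (M _ _); apply: val_inj => /=; first by rewrite ii' ord1.
    by rewrite jj'.
  - rewrite mulrC divfK //; congr (M _ _); apply: val_inj => /=.
      by rewrite ii'.
    by rewrite jj' ord1.
  rewrite big_ord1 !mxE addrC subrK; congr (M _ _); apply: val_inj => /=.
    by rewrite ii'.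
  by rewrite jj'.
have detE : \det (block_mx 1%:M 0 C 1%:M *m block_mx (a%:M : 'M[F]_1) r 0 S
    : 'M[F]_(1 + n)) = a * \det S.
  by rewrite det_mulmx det_lblock det_ublock !det1 det_scalar1 !mul1r.
by rewrite -detE.
Qed.

Section LinearChangeOfVariables.
Variable R : realType.

Local Notation T n := (n.-tuple (measurableTypeR R)).
Local Notation leb1 := (@lebesgue_measure R).
Local Notation leb := (@leb R).

Definition scales n (c : R) (f : T n -> T n) := [/\ (0 <= c)%R,
  measurable_fun setT f & forall A, measurable A ->
    (c%:E * leb n (f @^-1` A))%E = leb n A].

Lemma scales_comp n c d (f g : T n -> T n) :
  scales c f -> scales d g -> scales (d * c) (f \o g).
Proof.
case=> c0 mf fE [d0 mg gE]; split; first exact: mulr_ge0.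
  exact: measurableT_comp.
move=> A mA; rewrite comp_preimage mulrC EFinM -muleA gE ?fE //.
by rewrite -[X in measurable X]setTI; exact: mf.
Qed.

Lemma scales_fst n (a : R) (h : T n -> measurableTypeR R) (f : T n.+1 -> T n.+1) :
  a != 0 -> measurable_fun setT f ->
  (forall x t, f (tcons (x, t)) = tcons (a * x + h t, t)) -> scales `|a| f.
Proof.
move=> a0 mf fE; split=> // A mA.
have mfA : measurable (f @^-1` A) by rewrite -[X in measurable X]setTI; exact: mf.
rewrite !lebS_swap // -ge0_integralZl //; last exact: measurable_leb_section_swap.
apply: eq_integral => t _.
rewrite -[RHS](@lebesgue_measure_affine R a (h t)) //.
  by congr (_ * leb1 _)%E; apply/seteqP; split => x /=; rewrite fE.
exact: measurable_tcons_section_swap.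
Qed.

Lemma scales_snd n (c : R) (h : R -> T n -> T n) (f : T n.+1 -> T n.+1) :
  0 <= c -> measurable_fun setT f ->
  (forall x t, f (tcons (x, t)) = tcons (x, h x t)) ->
  (forall x, scales c (h x)) -> scales c f.
Proof.
move=> c0 mf fE hc; split=> // A mA.
have mfA : measurable (f @^-1` A) by rewrite -[X in measurable X]setTI; exact: mf.
rewrite !lebS -ge0_integralZl //; last exact: measurable_leb_section.
apply: eq_integral => x _; have [_ _ hE] := hc x; rewrite -[RHS]hE.
  by congr (_ * leb _ _)%E; apply/seteqP; split => t /=; rewrite fE.
exact: measurable_tcons_section.
Qed.

Definition affine n (M : 'M[R]_n) (b : 'I_n -> R) (t : T n) : T n :=
  [tuple \sum_j M i j * tnth t j + b i | i < n].

Lemma measurable_linear_form n (c : 'I_n -> R) (b : R) :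
  measurable_fun setT
    (fun t : T n => (\sum_j c j * tnth t j + b : R) : measurableTypeR R).
Proof.
apply: measurable_funD => //; apply: measurable_sum => j.
by apply: measurable_funM => //; exact: measurable_tnth.
Qed.

Lemma tnth_tcons0 n x (t : T n) : tnth (tcons (x, t)) ord0 = x.
Proof. by []. Qed.

Lemma tnth_tconsS n x (t : T n) i : tnth (tcons (x, t)) (lift ord0 i) = tnth t i.
Proof. by rewrite tnthS. Qed.

Lemma affine_tcons n (M : 'M[R]_n.+1) b x (t : T n) : affine M b (tcons (x, t)) =
  tcons (M ord0 ord0 * x + (\sum_j M ord0 (lift ord0 j) * tnth t j + b ord0),
    affine (\matrix_(i, j) M (lift ord0 i) (lift ord0 j))
      (fun i => M (lift ord0 i) ord0 * x + b (lift ord0 i)) t).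
Proof.
apply/eq_from_tnth => i; rewrite tnth_mktuple big_ord_recl tnth_tcons0.
under eq_bigr do rewrite tnth_tconsS.
case: (unliftP ord0 i) => [i' ->|->]; last by rewrite tnth_tcons0 addrA.
rewrite tnth_tconsS tnth_mktuple [RHS]addrCA [RHS]addrA.
by congr (_ + _ + _); apply: eq_bigr => j _; rewrite mxE.
Qed.

Lemma scales_affine_pivot n (M : 'M[R]_n.+1) b : M ord0 ord0 != 0 ->
  (forall (S : 'M[R]_n) d, S \in unitmx -> scales `|\det S| (affine S d)) ->
  M \in unitmx -> scales `|\det M| (affine M b).
Proof.
move=> a0 IH; rewrite unitmxE det_schur // unitrM unitfE a0 /= => uS.
set a := M ord0 ord0 in a0 uS *; set S := \matrix_(i, j) _ in uS *.
rewrite normrM.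
(* One step of Gaussian elimination: [f2] replaces the first coordinate by the
   first row of the map, and [f1] acts on the others by the Schur complement. *)
pose d y i := M (lift ord0 i) ord0 / a * (y - b ord0) + b (lift ord0 i).
pose f1 (t : T n.+1) : T n.+1 :=
  tcons (thead t, affine S (d (thead t)) [tuple of behead t]).
pose f2 (t : T n.+1) : T n.+1 := tcons
  ((\sum_j M ord0 j * tnth t j + b ord0 : R) : measurableTypeR R,
   [tuple of behead t]).
have f1E x t : f1 (tcons (x, t)) = tcons (x, affine S (d x) t).
  by congr (tcons (_, affine _ _ _)); apply: val_inj.
have f2E x t : f2 (tcons (x, t)) =
    tcons (a * x + (\sum_j M ord0 (lift ord0 j) * tnth t j + b ord0), t).
  rewrite /f2 big_ord_recl tnth_tcons0 -addrA.
  under eq_bigr do rewrite tnth_tconsS.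
  by congr (tcons (_, _)); apply: val_inj.
have -> : affine M b = f1 \o f2.
  apply/funext => t; rewrite -[t]tunconsK; case: (tuncons t) => x {}t.
  rewrite [RHS]/= f2E f1E affine_tcons; congr (tcons (_, _)).
  apply/eq_from_tnth => i; rewrite !tnth_mktuple.
  under eq_bigr do rewrite mxE.
  under [in RHS]eq_bigr do rewrite mxE mulrBl -[(_ / a * _) * _]mulrA.
  rewrite sumrB -mulr_sumr /d.
  set A := \sum_(_ < n) _; set B := \sum_(_ < n) _.
  by field.
apply: scales_comp.
  apply: (scales_snd (h := fun x => affine S (d x))) => //; last first.
    by move=> x; apply: IH; rewrite unitmxE.
  apply/measurable_fun_tnthP => i.
  case: (unliftP ord0 i) => [i' ->|->]; last exact: (measurable_tnth ord0).
  pose c (j : 'I_n.+1) : R := if unlift ord0 j is Some j' then S i' j'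
    else M (lift ord0 i') ord0 / a.
  pose e : R := b (lift ord0 i') - M (lift ord0 i') ord0 / a * b ord0.
  rewrite (_ : _ \o _ = fun t => (\sum_j c j * tnth t j + e : R)).
    exact: measurable_linear_form.
  apply/funext => t; rewrite -[t]tunconsK; case: (tuncons t) => x {}t.
  rewrite /= f1E tnth_tconsS tnth_mktuple big_ord_recl tnth_tcons0.
  under [in RHS]eq_bigr do rewrite tnth_tconsS /c liftK.
  rewrite /c unlift_none /d /e; set A := \sum_(_ < n) _.
  by field.
apply: (scales_fst (h := fun t =>
  (\sum_j M ord0 (lift ord0 j) * tnth t j + b ord0 : R))) => //.
apply: measurable_cons; first exact: measurable_linear_form.
exact: measurable_behead.
Qed.

Lemma scales_affine n (M : 'M[R]_n) b :
  M \in unitmx -> scales `|\det M| (affine M b).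
Proof.
elim: n M b => [|n IH] M b uM.
  rewrite det_mx00 normr1 (_ : affine M b = id); last first.
    by apply/funext => t; rewrite [t]tuple0; exact: tuple0.
  by split=> // A mA; rewrite mul1e.
have [a0|a0] := eqVneq (M ord0 ord0) 0; last exact: scales_affine_pivot.
have /existsP[i Mi0] : [exists i, M (lift ord0 i) ord0 != 0].
  apply: contraLR uM => /existsPn Mi; rewrite unitmxE unitfE negbK.
  rewrite (expand_det_col _ ord0) big1 // => i _.
  case: (unliftP ord0 i) => [i' ->|->]; last by rewrite a0 mul0r.
  by have := Mi i'; rewrite negbK => /eqP ->; rewrite mul0r.
(* [U] adds the row of index i + 1 to the first one, which makes the pivot
   nonzero, and [g] undoes it. *)
pose U : 'M[R]_n.+1 := 1%:M + delta_mx ord0 (lift ord0 i).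
have detU : \det U = 1.
  rewrite -det_tr det_trig.
    apply: big1 => j _; rewrite !mxE eqxx.
    by case: eqP => [->|_] //=; rewrite addr0.
  apply/is_trig_mxP => j k jk; rewrite !mxE.
  have /negbTE -> : k != j by rewrite neq_ltn jk orbT.
  case: eqP => [k0|_]; last by rewrite addr0.
  by rewrite k0 in jk.
have UE j k : (U *m M) j k = M j k + (j == ord0)%:R * M (lift ord0 i) k.
  rewrite mulmxDl mul1mx !mxE (bigD1 (lift ord0 i)) //= big1 => [|l li].
    by rewrite !mxE eqxx andbT addr0.
  by rewrite !mxE (negbTE li) andbF mul0r.
pose b' j := b j + (j == ord0)%:R * b (lift ord0 i).
pose g (t : T n.+1) : T n.+1 := tcons
  ((thead t - tnth t (lift ord0 i) : R) : measurableTypeR R,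
    [tuple of behead t]).
have -> : affine M b = g \o affine (U *m M) b'.
  apply/funext => t; apply/eq_from_tnth => j; rewrite tnth_mktuple /=.
  case: (unliftP ord0 j) => [j' ->|->]; last first.
    rewrite tnth_tcons0 [thead _]tnth_mktuple tnth_mktuple.
    under [in RHS]eq_bigr do rewrite UE mulrDl mul1r.
    under [X in _ = _ - (X + _)]eq_bigr do rewrite UE mul0r addr0.
    by rewrite big_split /= /b' eqxx mul1r /= mul0r addr0; ring.
  rewrite tnth_tconsS tnth_behead.
  rewrite (_ : inord _ = lift ord0 j'); last first.
    by apply: val_inj; rewrite /= inordK // ltnS.
  rewrite tnth_mktuple /b' /= mul0r addr0; congr (_ + _).
  by apply: eq_bigr => k _; rewrite UE mul0r addr0.
rewrite (_ : \det M = \det (U *m M)); last by rewrite det_mulmx detU mul1r.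
rewrite -[X in scales X]mulr1; apply: scales_comp.
  rewrite -[X in scales X _]normr1.
  apply: (scales_fst (h := fun t => (- tnth t i : R))); first exact: oner_neq0.
    apply: measurable_cons; last exact: measurable_behead.
    apply: measurable_funB; exact: measurable_tnth.
  move=> x t; rewrite mul1r /g tnth_tconsS; congr (tcons (_, _)).
  exact: val_inj.
apply: scales_affine_pivot => //.
  by rewrite UE eqxx mul1r a0 add0r.
by rewrite unitmx_mul uM andbT unitmxE detU unitr1.
Qed.

Definition unit_cube n : set (n.-tuple R) := [set s | forall i, 0 <= tnth s i <= 1].

Lemma lebesgue_n_unit_cube n : lebesgue_n (@unit_cube n) = 1%E.
Proof.
elim: n => [|n IH] /=.
  by rewrite indicE (_ : _ \in _) // inE => -[].
transitivity (\int[leb1]_x (\1_`[0, 1]%classic x)%:E)%E.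
  apply: eq_integral => x _; rewrite indicE.
  case: (boolP (x \in `[0, 1]%classic)) => [|/negP] x01.
    rewrite -[RHS]IH; congr lebesgue_n; apply/seteqP; split => t /= ht i.
      by have := ht (lift ord0 i); rewrite tnth_tconsS.
    case: (unliftP ord0 i) => [i' ->|->]; first by rewrite tnth_tconsS.
    by move: x01; rewrite inE /= in_itv.
  rewrite (_ : mkset _ = set0) -?lebE ?measure0 //.
  apply/seteqP; split => t //= /(_ ord0); rewrite tnth_tcons0 => h.
  by apply: x01; rewrite inE /= in_itv.
rewrite integral_indic // setIT /= lebesgue_measure_itv /= lte_fin ltr01.
by rewrite -EFinB subr0.
Qed.

Lemma lebesgue_n_hyperplane n (v : 'I_n -> R) (c : R) : (exists i, v i != 0) ->
  lebesgue_n [set t : n.-tuple R | \sum_i v i * tnth t i = c] = 0%E.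
Proof.
rewrite -lebE; elim: n v c => [|n IH] v c [i vi]; first by case: i vi.
have mA : measurable [set t : T n.+1 | \sum_i v i * tnth t i = c].
  rewrite -[X in measurable X]setTI.
  rewrite (_ : mkset _ = (fun t : T n.+1 => (\sum_i v i * tnth t i + 0 : R))
    @^-1` [set c]); last by apply/seteqP; split => t /=; rewrite addr0.
  by apply: (measurable_linear_form v 0) => //; exact: measurable_set1.
have vE x (t : T n) : \sum_i v i * tnth (tcons (x, t)) i =
    v ord0 * x + \sum_i v (lift ord0 i) * tnth t i.
  rewrite big_ord_recl tnth_tcons0.
  by under eq_bigr do rewrite tnth_tconsS.
have [v0|v0] := eqVneq (v ord0) 0.
  rewrite lebS; apply: integral0_eq => x _.
  rewrite -[RHS](IH (fun i => v (lift ord0 i)) c).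
    congr (leb _ _); apply/seteqP; split => t; rewrite /mkset vE v0 mul0r add0r //.
  case: (unliftP ord0 i) => [i' i'E|iE]; first by exists i'; rewrite -i'E.
  by rewrite iE v0 eqxx in vi.
rewrite lebS_swap //; apply: integral0_eq => t _.
pose s := \sum_i v (lift ord0 i) * tnth t i.
rewrite (_ : mkset _ = [set (c - s) / v ord0]); first exact: lebesgue_measure_set1.
apply/seteqP; split => x; rewrite /mkset vE -/s /set1 /mkset => xE.
  by rewrite -xE; field.
by rewrite xE; field.
Qed.

Lemma lebesgue_n_affine_cube n (M : 'M[R]_n) (b : 'I_n -> R) :
  lebesgue_n [set t : n.-tuple R | exists2 s, unit_cube s & t = affine M b s]
    = `|\det M|%:E.
Proof.
have [uM|] := boolP (M \in unitmx).
  pose b' i := - \sum_j invmx M i j * b j.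
  have MK : cancel (affine M b) (affine (invmx M) b').
    move=> t; apply/eq_from_tnth => i; rewrite tnth_mktuple.
    under eq_bigr do rewrite tnth_mktuple mulrDr.
    rewrite big_split /= /b' addrK.
    under eq_bigr do rewrite mulr_sumr.
    rewrite exchange_big /=.
    under eq_bigr => j _.
      under eq_bigr do rewrite mulrA.
      rewrite -mulr_suml (_ : \sum_(_ < n) _ = (invmx M *m M) i j); last by rewrite mxE.
      rewrite mulVmx // mxE; over.
    by rewrite (bigD1 i) //= big1 ?eqxx ?mul1r ?addr0 // => j ji; rewrite eq_sym (negbTE ji) mul0r.
  have MVK : cancel (affine (invmx M) b') (affine M b).
    move=> t; apply/eq_from_tnth => i; rewrite tnth_mktuple.
    under eq_bigr do rewrite tnth_mktuple mulrDr.
    rewrite big_split /= /b'.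
    under eq_bigr do rewrite mulr_sumr.
    under [X in _ + X + _]eq_bigr do rewrite mulrN mulr_sumr.
    rewrite sumrN exchange_big [X in _ - X + _]exchange_big /=.
    have K j c : \sum_k M i k * (invmx M k j * c) = (i == j)%:R * c.
      under eq_bigr do rewrite mulrA.
      rewrite -mulr_suml (_ : \sum_(_ < n) _ = (M *m invmx M) i j); last by rewrite mxE.
      by rewrite mulmxV // mxE.
    under eq_bigr do rewrite K.
    under [X in _ - X + _]eq_bigr do rewrite K.
    rewrite (bigD1 i) //= [X in _ - X + _](bigD1 i) //= !big1 ?eqxx ?mul1r ?addr0.
    - by rewrite subrK.
    - by move=> j ji; rewrite eq_sym (negbTE ji) mul0r.
    - by move=> j ji; rewrite eq_sym (negbTE ji) mul0r.
  rewrite (_ : mkset _ = affine (invmx M) b' @^-1` (@unit_cube n)); last first.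
    apply/seteqP; split => [t [s cs ->]|t ct] /=; first by rewrite MK.
    by exists (affine (invmx M) b' t) => //; rewrite MVK.
  have mcube : measurable (@unit_cube n : set (T n)).
    rewrite (_ : @unit_cube n = \bigcap_(i in [set: 'I_n])
        ((fun t : T n => tnth t i) @^-1` `[0, 1]%classic)).
      apply: fin_bigcap_measurable => // i _.
      rewrite -[X in measurable X]setTI.
      exact: (@measurable_tnth _ (measurableTypeR R) n i measurableT _
        (measurable_itv _)).
    apply/seteqP; split => t /= ht i; first by move=> _; rewrite /= in_itv /=; exact: ht.
    by have := ht i I; rewrite /= in_itv.
  have uV : invmx M \in unitmx by rewrite unitmx_inv.
  have [_ _ /(_ _ mcube)] := scales_affine b' uV.
  rewrite !lebE lebesgue_n_unit_cube det_inv => cubeE.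
  have d0 : \det M != 0 by rewrite -unitfE -unitmxE.
  rewrite -[RHS]mule1 -cubeE muleA -EFinM -normrM mulfV // normr1 mul1e.
  by [].
(* If M is singular, the image of the cube lies in a hyperplane. *)
rewrite unitmxE unitfE negbK => /eqP d0; rewrite d0 normr0.
have /det0P[v v0 vM] : \det M == 0 by rewrite d0.
apply/eqP; rewrite eq_le lebesgue_n_ge0 andbT.
apply: (@le_trans _ _ (lebesgue_n [set t : n.-tuple R |
    \sum_i v ord0 i * tnth t i = \sum_i v ord0 i * b i])); last first.
  rewrite lebesgue_n_hyperplane //.
  apply/existsP; apply: contraNT v0 => /existsPn v0; apply/eqP/rowP => i.
  by rewrite mxE; apply/eqP; have := v0 i; rewrite negbK.
apply: le_lebesgue_n => _ [s _ ->] /=.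
under eq_bigr do rewrite tnth_mktuple mulrDr.
rewrite big_split /= -[RHS]add0r; congr (_ + _).
under eq_bigr do rewrite mulr_sumr.
rewrite exchange_big big1 //= => j _.
under eq_bigr do rewrite mulrA.
rewrite -mulr_suml (_ : \sum_(_ < n) _ = (v *m M) ord0 j); last by rewrite mxE.
by rewrite vM mxE mul0r.
Qed.

End LinearChangeOfVariables.

(** * Exterior algebra in coordinates *)

Section FunctionalDeterminant.
Variables (F : fieldType) (X : vectType F).
Implicit Types (a : nat -> X -> F) (ws : seq X).

Definition fundet p a ws : F := \det (\matrix_(i < p, j < p) a i ws`_j).

Lemma fundet_insert p a l1 w l2 : (size l1 <= p)%N ->
  fundet p.+1 a (l1 ++ w :: l2) = \sum_(k < p.+1) a k w *
    ((-1) ^+ (k + size l1) * fundet p (fun i => a (bump k i)) (l1 ++ l2)).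
Proof.
move=> l1p; rewrite /fundet (expand_det_col _ (Ordinal (l1p : size l1 < p.+1)%N)).
apply: eq_bigr => k _; rewrite mxE /= nth_cat ltnn subnn /=; congr (_ * (_ * _)).
congr (\det _); apply/matrixP => i j; rewrite !mxE /=; congr (a _ _).
rewrite !nth_cat /bump; case: (leqP (size l1) j) => jl.
  rewrite add1n (_ : (j.+1 < _)%N = false); last by rewrite ltnNge leqW.
  by rewrite subSn.
by rewrite add0n jl.
Qed.

Lemma fundet_cons p a w ws : fundet p.+1 a (w :: ws) =
  \sum_(k < p.+1) a k w * ((-1) ^+ k * fundet p (fun i => a (bump k i)) ws).
Proof.
rewrite (fundet_insert (l1 := [::]) _ _ _ (leq0n _)).
by under eq_bigr do rewrite addn0.
Qed.

Lemma fundet_move p a l1 w l2 : (size l1 <= p)%N ->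
  fundet p.+1 a (l1 ++ w :: l2) = (-1) ^+ size l1 * fundet p.+1 a (w :: l1 ++ l2).
Proof.
move=> l1p; rewrite fundet_insert // fundet_cons mulr_sumr.
by apply: eq_bigr => k _; rewrite exprD; ring.
Qed.

Lemma fundet_dup p a w ws j : (j < p)%N -> ws`_j = w -> fundet p.+1 a (w :: ws) = 0.
Proof.
move=> jp wj; rewrite /fundet -det_tr.
apply: (determinant_alternate (i1 := ord0) (i2 := lift ord0 (Ordinal jp))) => // k.
by rewrite !mxE /= wj.
Qed.

End FunctionalDeterminant.

Section ExteriorAlgebraTheory.
Variables (F : fieldType) (X : vectType F).
Local Notation n := (\dim (fullv : {vspace X})).
Local Notation e i := ((vbasis (fullv : {vspace X}))`_i).
Implicit Types (S T U V : {set 'I_n}) (a b c : multivector X).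

Definition basis_seq S : seq X := [seq e i | i : 'I_n <- enum S].

(* [asboolP] appears because the comprehension in [inversions] is a classical
   set. *)
Lemma card_lt_inversions i T :
  inversions [set i]%SET T = #|[set j in T | (j < i)%N]%SET|.
Proof.
rewrite /inversions -[RHS](card_imset _ (f := fun j => (i, j))); last by move=> ? ? [].
apply: eq_card => -[k j]; apply/asboolP/imsetP => /= [/and3P[]|].
  rewrite !inE => /eqP -> jT ji.
  by exists j; rewrite // inE jT.
by case=> j'; rewrite inE => /andP[jT ji] [-> ->]; rewrite !inE eqxx jT.
Qed.

Lemma enum_insert i U : i \notin U -> exists l1 l2 : seq 'I_n,
  [/\ enum (i |: U)%SET = l1 ++ i :: l2, enum U = l1 ++ l2 &
      size l1 = inversions [set i]%SET U].
Proof.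
move=> iU; pose s := enum 'I_n.
have us : uniq s by exact: enum_uniq.
have os : pairwise (fun j k : 'I_n => (j < k)%N) s.
  rewrite -(pairwise_map val (fun j k => (j < k)%N)) val_enum_ord.
  by rewrite -sorted_pairwise ?iota_ltn_sorted //; exact: ltn_trans.
have enumE (A : {set 'I_n}) : enum A = [seq j <- s | j \in A].
  by rewrite /s enumT.
have : i \in s by rewrite mem_enum.
move: us os enumE; rewrite /s => + + + /splitPr sE.
case: sE => s1 s2 us os enumE.
move: us; rewrite cat_uniq /= negb_or => /and3P[_ /andP[is1 _] /andP[is2 _]].
move: os; rewrite pairwise_cat /= => /and3P[/allrelP s1lt _ /andP[/allP ilt _]].
exists [seq j <- s1 | j \in U], [seq j <- s2 | j \in U].
have setU1E s' : i \notin s' ->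
    [seq j <- s' | j \in (i |: U)%SET] = [seq j <- s' | j \in U].
  move=> is'; apply: eq_in_filter => j js'; rewrite !inE.
  by case: eqP js' is' => // -> ->.
split.
- by rewrite enumE filter_cat /= finset.setU11 !setU1E.
- by rewrite enumE filter_cat /= (negbTE iU).
rewrite card_lt_inversions cardE enumE filter_cat /= inE (negbTE iU) /=.
rewrite [X in _ = size (_ ++ X)](_ : _ = [::]) ?cats0.
  congr size; apply: eq_in_filter => j js1; rewrite inE.
  by rewrite (s1lt j i) ?andbT // mem_head.
apply/eqP; rewrite -[_ == _]negbK -has_filter; apply/hasPn => j js2; rewrite inE negb_and.
by rewrite -leqNgt ltnW ?orbT //; exact: ilt.
Qed.

Lemma mv_wedge_vec v b T : mv_wedge (mv_vec v) b T =
  \sum_(i in T) (-1) ^+ inversions [set i]%SET (T :\ i)%SET *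
    coord (vbasis fullv) i v * b (T :\ i)%SET.
Proof.
rewrite ffunE.
under eq_bigr => S _ do rewrite ffunE mulr_sumr mulr_suml.
rewrite (exchange_big_dep (fun i => i \in T)) /=; last first.
  by move=> S i ST /eqP SE; rewrite -finset.sub1set -SE.
apply: eq_bigr => i iT; rewrite (bigD1 [set i]%SET) /= ?finset.sub1set ?iT ?eqxx //.
by rewrite big1 ?addr0 // => S /andP[/andP[_ /eqP ->]]; rewrite eqxx.
Qed.

Lemma mv_wedges_grade vs T : #|T| != size vs -> mv_wedges vs T = 0.
Proof.
elim: vs T => [|v vs IH] T /= cT.
  by rewrite ffunE -cards_eq0 (negbTE cT).
rewrite mv_wedge_vec big1 // => i iT; rewrite IH ?mulr0 //.
by apply: contra cT => /eqP <-; rewrite (cardsD1 i T) iT.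
Qed.

Lemma sum_mv_wedges_fundet ws (a : nat -> {scalar X}) :
  \sum_(T : {set 'I_n} | #|T| == size ws)
     mv_wedges ws T * fundet (size ws) a (basis_seq T) = fundet (size ws) a ws.
Proof.
elim: ws a => [|w ws IH] a /=.
  rewrite (big_pred1 finset.set0); last by move=> T /=; rewrite cards_eq0.
  by rewrite ffunE eqxx mul1r /fundet !det_mx00.
set p := size ws; pose W := mv_wedges ws.
pose c i := coord (vbasis (fullv : {vspace X})) i w.
have swap i U : i \notin U -> #|U| == p ->
    fundet p.+1 a (basis_seq (i |: U)%SET) =
    (-1) ^+ inversions [set i]%SET U * fundet p.+1 a (e i :: basis_seq U).
  move=> iU /eqP Up; have [l1 [l2 [iUE UE <-]]] := enum_insert iU.
  rewrite /basis_seq iUE UE !map_cat /= fundet_move ?size_map //.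
  by rewrite -Up cardE UE size_cat leq_addr.
transitivity (\sum_i \sum_(U : {set 'I_n} | #|U| == p)
    c i * (W U * fundet p.+1 a (e i :: basis_seq U))).
  under eq_bigr => T _ do rewrite mv_wedge_vec mulr_suml.
  rewrite (exchange_big_dep xpredT) //=; apply: eq_bigr => i _.
  rewrite [RHS](bigID (fun U => i \in U)) /= [X in _ = X + _]big1 ?add0r; last first.
    move=> U /andP[/eqP Up iU].
    rewrite (@fundet_dup _ _ p _ _ _ (index i (enum U))) ?mulr0 //.
      by rewrite -Up cardE index_mem mem_enum.
    by rewrite (nth_map i) ?index_mem ?mem_enum // nth_index // mem_enum.
  rewrite [RHS](reindex_onto (fun T => T :\ i)%SET (fun U => i |: U)%SET) /=.
    apply: eq_big => [T|T /andP[/eqP Tp iT]].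
      case: (boolP (i \in T)) => iT.
        rewrite finset.setD1K // eqxx finset.setD11 !andbT (cardsD1 i T) iT add1n eqSS //.
      rewrite andbF; apply/esym/negbTE; apply: contra iT => /andP[_ /eqP <-].
      exact: finset.setU11.
    have := swap i (T :\ i)%SET; rewrite finset.setD11 finset.setD1K // => -> //.
      set sg := (-1) ^+ _; have sg2 : sg * sg = 1 by rewrite -expr2 sqrr_sign.
      by rewrite /c /W; ring: sg2.
    by move: Tp; rewrite (cardsD1 i T) iT add1n => -[->].
  by move=> U /andP[_ iU]; rewrite finset.setU1K.
under eq_bigr => i _.
  under eq_bigr => U _ do rewrite fundet_cons mulr_sumr mulr_sumr.
  rewrite exchange_big /=.
  under eq_bigr => k _.
    rewrite (_ : \sum_(_ | _) _ = c i * a k (e i) * ((-1) ^+ k *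
      \sum_(U : {set 'I_n} | #|U| == p)
        W U * fundet p (fun j => a (bump k j)) (basis_seq U))); last first.
      by rewrite !mulr_sumr; apply: eq_bigr => U _; ring.
    rewrite (IH (fun j => a (bump k j))); over.
  over.
rewrite exchange_big fundet_cons /=; apply: eq_bigr => k _.
rewrite -mulr_suml; congr (_ * _).
rewrite [in RHS](coord_vbasis (memvf w)) linear_sum; apply: eq_bigr => i _.
by rewrite linearZ.
Qed.

End ExteriorAlgebraTheory.

Section ExteriorAlgebraAssoc.
Variables (F : fieldType) (X : vectType F).
Local Notation n := (\dim (fullv : {vspace X})).
Local Notation fdisjoint A B := (fintype.disjoint (mem A) (mem B)).
Implicit Types (S T U V : {set 'I_n}) (a b c : multivector X).

Lemma inversionsE S T : inversions S T = (\sum_(i in S) \sum_(j in T) (j < i))%N.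
Proof.
rewrite /inversions -sum1_card big_mkcond [RHS]big_mkcond /=.
under [RHS]eq_bigr => i _ do rewrite big_mkcond (fun_if (fun x => x : nat)) /=.
transitivity (\sum_i \sum_j if [&& i \in S, j \in T & (j < i)%N] then 1 else 0)%N.
  rewrite pair_bigA /=; apply: eq_bigr => -[i j] _ /=.
  by congr (if _ then _ else _); apply/asboolP/idP.
apply: eq_bigr => i _; case: (i \in S) => /=; last by rewrite big1.
by apply: eq_bigr => j _; case: (j \in T) => //=; case: ltnP.
Qed.

Lemma sum_setU S T (f : 'I_n -> nat) : fdisjoint S T ->
  (\sum_(i in S :|: T) f i)%N = (\sum_(i in S) f i + \sum_(i in T) f i)%N.
Proof.
by move=> dST; rewrite -bigU //; apply: eq_bigl => i; rewrite !inE.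
Qed.

Lemma inversionsUl S T U : fdisjoint S T ->
  inversions (S :|: T)%SET U = (inversions S U + inversions T U)%N.
Proof. by move=> dST; rewrite !inversionsE sum_setU. Qed.

Lemma inversionsUr S T U : fdisjoint T U ->
  inversions S (T :|: U)%SET = (inversions S T + inversions S U)%N.
Proof.
move=> dTU; rewrite !inversionsE -big_split /=.
by apply: eq_bigr => i _; rewrite sum_setU.
Qed.

Lemma inversions0l T : inversions finset.set0 T = 0%N.
Proof. by rewrite inversionsE big1 // => i; rewrite inE. Qed.

Lemma mv_wedgeA a b c : mv_wedge (mv_wedge a b) c = mv_wedge a (mv_wedge b c).
Proof.
apply/ffunP => U; rewrite !ffunE.
under eq_bigr => S _ do rewrite ffunE mulr_sumr mulr_suml.
rewrite (exchange_big_dep (fun T => T \subset U)) /=; last first.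
  by move=> S T SU TS; exact: fintype.subset_trans TS SU.
apply: eq_bigr => T TU; rewrite ffunE mulr_sumr.
rewrite (reindex_onto (fun V => T :|: V)%SET (fun S => S :\: T)%SET) /=; last first.
  move=> S /andP[_ TS]; apply/finset.setP => i; rewrite !inE.
  by case: (boolP (i \in T)) => //= /(fintype.subsetP TS) ->.
have UTE V : [&& T :|: V \subset U, T \subset T :|: V & (T :|: V) :\: T == V]%SET =
    (V \subset U :\: T)%SET.
  apply/and3P/idP => [[TVU _ /eqP <-]|]; first exact: finset.setSD.
  rewrite finset.subsetD => /andP[VU dVT]; split.
  - by rewrite finset.subUset TU.
  - exact: finset.subsetUl.
  - by rewrite finset.setDUl finset.setDv finset.set0U; apply/eqP/finset.setDidPl.
apply: eq_big => [V|V]; first by rewrite -UTE andbA.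
rewrite -andbA UTE finset.subsetD => /andP[VU dVT].
have dTV : fdisjoint T V by rewrite disjoint_sym.
set W := ((U :\: T) :\: V)%SET.
have -> : (U :\: (T :|: V) = W)%SET by rewrite /W finset.setDDl.
have -> : ((T :|: V) :\: T = V)%SET.
  by rewrite finset.setDUl finset.setDv finset.set0U; apply/finset.setDidPl.
have -> : (U :\: T = V :|: W)%SET.
  rewrite -[LHS](finset.setID _ V); congr (_ :|: _).
  by apply/finset.setIidPr; rewrite finset.subsetD VU.
have dVW : fdisjoint V W.
  rewrite -finset.setI_eq0; apply/eqP/finset.setP => i; rewrite !inE.
  by case: (i \in V).
rewrite inversionsUl // inversionsUr // !exprD.
by move: ((-1) ^+ _) ((-1) ^+ _) ((-1) ^+ _) (a T) (b V) (c W) => x y z u v w; ring.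
Qed.

Definition mv_scale (k : F) a : multivector X := [ffun S : {set 'I_n} => k * a S].

Lemma mv_wedge_scale k l a b :
  mv_wedge (mv_scale k a) (mv_scale l b) = mv_scale (k * l) (mv_wedge a b).
Proof.
apply/ffunP => U; rewrite !ffunE mulr_sumr; apply: eq_bigr => S _.
rewrite !ffunE; move: ((-1) ^+ _) (a S) (b _) => x y z; ring.
Qed.

Lemma mv_scalarE k : mv_scalar X k = mv_scale k (mv_wedges [::]).
Proof.
by apply/ffunP => S; rewrite !ffunE; case: eqP; rewrite ?mulr1 ?mulr0.
Qed.

Lemma mv_scale1 a : mv_scale 1 a = a.
Proof. by apply/ffunP => S; rewrite ffunE mul1r. Qed.

Lemma mv_wedge1l a : mv_wedge (mv_scalar X 1) a = a.
Proof.
apply/ffunP => U; rewrite ffunE (bigD1 finset.set0) ?finset.sub0set //= big1.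
  by rewrite ffunE eqxx inversions0l finset.setD0 addr0 !mul1r.
by move=> S /andP[_ S0]; rewrite ffunE (negbTE S0) mulr0 mul0r.
Qed.

Lemma mv_wedges_cat vs ws :
  mv_wedge (mv_wedges vs) (mv_wedges ws) = mv_wedges (X := X) (vs ++ ws).
Proof.
elim: vs => [|v vs IH]; first exact: mv_wedge1l.
by rewrite /= mv_wedgeA; congr mv_wedge.
Qed.

Lemma mv_wedges_set0 vs : (0 < size vs)%N -> mv_wedges (X := X) vs finset.set0 = 0.
Proof. by move=> vs0; rewrite mv_wedges_grade // cards0 neq_ltn vs0. Qed.

(* Scalars are multiples of the empty wedge, whose span is 0. *)
Lemma bladeP a : a != [ffun => 0] -> is_blade a -> exists (k : F) (vs : seq X),
  a = mv_scale k (mv_wedges vs) /\ blade_space a = <<vs>>%VS.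
Proof.
move=> a0 [[k aE]|[vs [vs0 aE]]].
  exists k, [::]; rewrite -mv_scalarE span_nil; split=> //.
  rewrite /blade_space; case: xgetP => // V _ [_ [vs [vs0 aE' _]]].
  have k0 : k = 0.
    have := mv_wedges_set0 vs0; rewrite -aE' aE ffunE eqxx //.
  by case/eqP: a0; rewrite aE k0; apply/ffunP => S; rewrite !ffunE; case: ifP.
rewrite /blade_space; case: xgetP => [V _ [_ [ws [ws0 aE' ->]]]|].
  by exists 1, ws; rewrite mv_scale1.
by move=> /(_ <<vs>>%VS)[]; split=> //; exists vs.
Qed.

End ExteriorAlgebraAssoc.

(** * Gram determinants and orthogonal projections *)

Section GroundTheory.
Variables (R : realType) (K : ground).
Local Notation F := (ground_field R K).
Implicit Types (s t : R) (z w : F).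

Lemma of_realM s t : of_real K (s * t) = of_real K s * of_real K t.
Proof. by case: K => //=; rewrite rmorphM. Qed.

Lemma of_real0 : of_real K 0 = 0 :> F.
Proof. by case: K. Qed.

Lemma of_real1 : of_real K 1 = 1 :> F.
Proof. by case: K. Qed.

Lemma real_part_is_zmod_morphism : zmod_morphism (@real_part R K).
Proof. by case: K => //= -[a b] [c d]. Qed.

HB.instance Definition _ := GRing.isZmodMorphism.Build F R (@real_part R K)
  real_part_is_zmod_morphism.

Lemma of_real_is_zmod_morphism : zmod_morphism (@of_real R K).
Proof. by case: K => // s t /=; rewrite rmorphB. Qed.

Lemma of_real_is_monoid_morphism : monoid_morphism (@of_real R K).
Proof. by split=> [|s t]; [exact: of_real1|exact: of_realM]. Qed.

HB.instance Definition _ := GRing.isZmodMorphism.Build R F (@of_real R K)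
  of_real_is_zmod_morphism.
HB.instance Definition _ := GRing.isMonoidMorphism.Build R F (@of_real R K)
  of_real_is_monoid_morphism.

Lemma of_realK : cancel (of_real K) (@real_part R K).
Proof. by case: K. Qed.

Lemma real_partZ s z : real_part (of_real K s * z) = s * real_part z.
Proof. by case: K z => //= -[a b] /=; rewrite mul0r subr0. Qed.

Lemma sconj_of_real s : sconj R K (of_real K s) = of_real K s.
Proof. by case: K => //=; apply/eqP; rewrite eq_complex /= oppr0 !eqxx. Qed.

Lemma ge0_of_real z : 0 <= z -> of_real K (real_part z) = z.
Proof.
by case: K z => //= -[a b]; rewrite lecE /= => /andP[/eqP -> _].
Qed.

Lemma real_part_gt0 z : 0 < z -> 0 < real_part z.
Proof. by case: K z => //= -[a b]; rewrite ltcE /= => /andP[_]. Qed.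

Definition sqnorm z : R := real_part (sconj R K z * z).

Lemma sqnormE z : of_real K (sqnorm z) = sconj R K z * z.
Proof.
rewrite /sqnorm; case: K z => //= -[a b]; apply/eqP; rewrite eq_complex /= eqxx /=.
by apply/eqP; ring.
Qed.

Lemma sqnormM z w : sqnorm (z * w) = sqnorm z * sqnorm w.
Proof.
by apply: (can_inj of_realK); rewrite of_realM !sqnormE rmorphM; ring.
Qed.

Lemma sqnorm_ge0 z : 0 <= sqnorm z.
Proof.
rewrite /sqnorm; case: K z => [z|[a b]] /=; first by rewrite -expr2 sqr_ge0.
by rewrite mulNr opprK addr_ge0 // -expr2 sqr_ge0.
Qed.

Lemma sqnorm1 : sqnorm 1 = 1.
Proof. by rewrite /sqnorm rmorph1 mulr1 -of_real1 of_realK. Qed.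

End GroundTheory.

Section GramDeterminant.
Variables (R : realType) (K : ground) (X : vectType (ground_field R K)).
Variable dot : {dot X for sconj R K}.
Local Notation F := (ground_field R K).
Local Notation ip := (ip dot).
Local Notation n := (\dim (fullv : {vspace X})).
Implicit Types (u v w : X) (c : F) (us vs ws : seq X).

Lemma ip_is_linear v : scalar (ip v : X -> F).
Proof. by move=> c u w; rewrite /ip linearPl. Qed.

HB.instance Definition _ v := GRing.isLinear.Build F X F _ (ip v)
  (ip_is_linear v).

Lemma ip_sym v w : ip v w = sconj R K (ip w v).
Proof. by rewrite /ip hermC expr0 mul1r. Qed.

Lemma ipDl u v w : ip (u + v) w = ip u w + ip v w.
Proof. by rewrite ip_sym linearD rmorphD /= -!ip_sym. Qed.

Lemma ipZl c v w : ip (c *: v) w = sconj R K c * ip v w.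
Proof. by rewrite ip_sym linearZ rmorphM /= -!ip_sym. Qed.

Lemma ip_suml I r (P : pred I) (f : I -> X) w :
  ip (\sum_(i <- r | P i) f i) w = \sum_(i <- r | P i) ip (f i) w.
Proof. by rewrite ip_sym linear_sum rmorph_sum; apply: eq_bigr => i _; rewrite /= -ip_sym. Qed.

Lemma ipZr c v w : ip v (c *: w) = c * ip v w.
Proof. exact: linearZ. Qed.

Lemma ip_sumr I r (P : pred I) (f : I -> X) v :
  ip v (\sum_(i <- r | P i) f i) = \sum_(i <- r | P i) ip v (f i).
Proof. exact: linear_sum. Qed.

Lemma ip_gt0 v : v != 0 -> 0 < ip v v.
Proof. exact: neq0_dnorm_gt0. Qed.

Lemma ip_self v : ip v v = of_real K (real_part (ip v v)).
Proof.
have [->|v0] := eqVneq v 0; first by rewrite linear0 raddf0 of_real0.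
by rewrite ge0_of_real // ltW // ip_gt0.
Qed.

Lemma gram_det_sym vs ws : size vs = size ws ->
  gram_det dot vs ws = sconj R K (gram_det dot ws vs).
Proof.
move=> vw; rewrite /gram_det -det_map_mx -det_tr vw; congr (\det _).
by apply/matrixP => i j; rewrite !mxE; exact: ip_sym.
Qed.

Lemma gram_detE vs ws : gram_det dot vs ws = fundet (size vs) (fun i => ip vs`_i) ws.
Proof. by []. Qed.

Lemma sum_mv_wedges_gram_det vs ws : size vs = size ws ->
  \sum_(T : {set 'I_n} | #|T| == size ws)
    mv_wedges ws T * gram_det dot vs (basis_vectors T) = gram_det dot vs ws.
Proof.
move=> vw; rewrite [RHS]gram_detE vw.
rewrite -(sum_mv_wedges_fundet ws (fun i => ip vs`_i)).
by apply: eq_bigr => T _; rewrite gram_detE vw.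
Qed.

Lemma mv_ip_wedges vs ws : size vs = size ws ->
  mv_ip dot (mv_wedges vs) (mv_wedges ws) = gram_det dot vs ws.
Proof.
move=> vw; rewrite /mv_ip (bigID (fun S : {set 'I_n} => #|S| == size ws)) /=.
rewrite [X in _ + X]big1 ?addr0 => [|S Sw]; last first.
  by rewrite big1 // => T _; rewrite mv_wedges_grade ?vw // rmorph0 !mul0r.
have bs (T : {set 'I_n}) : size (basis_vectors (X := X) T) = #|T|.
  by rewrite size_map -cardE.
transitivity (\sum_(S : {set 'I_n} | #|S| == size ws)
    sconj R K (mv_wedges vs S) * gram_det dot (basis_vectors S) ws).
  apply: eq_bigr => S /eqP Sw; rewrite -sum_mv_wedges_gram_det ?bs // mulr_sumr Sw.
  by apply: eq_bigr => T _; rewrite mulrA.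
rewrite gram_det_sym // -sum_mv_wedges_gram_det // rmorph_sum vw.
by apply: eq_bigr => S /eqP Sw; rewrite rmorphM gram_det_sym // bs.
Qed.

Lemma mv_ip_scale (a b : multivector X) c :
  mv_ip dot (mv_scale c a) (mv_scale c b) = sconj R K c * c * mv_ip dot a b.
Proof.
rewrite /mv_ip mulr_sumr; apply: eq_bigr => S _; rewrite mulr_sumr.
by apply: eq_bigr => T _; rewrite !ffunE rmorphM; ring.
Qed.

Definition sqvol vs : R := real_part (gram_det dot vs vs).

Lemma mv_norm_scale_wedges c vs :
  mv_norm dot (mv_scale c (mv_wedges vs)) = Num.sqrt (sqnorm c * sqvol vs).
Proof. by rewrite /mv_norm mv_ip_scale mv_ip_wedges // -sqnormE real_partZ. Qed.

End GramDeterminant.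

Section OrthogonalGeometry.
Variables (R : realType) (K : ground) (X : vectType (ground_field R K)).
Variable dot : {dot X for sconj R K}.
Local Notation F := (ground_field R K).
Local Notation ip := (ip dot).
Local Notation oc := (orth_compl dot).
Local Notation gram_det := (gram_det dot).
Implicit Types (u v w : X) (c : F) (s us vs ws es : seq X) (U V W : {vspace X}).

Lemma span_lincomb s v : v \in << s >>%VS ->
  exists c : 'I_(size s) -> F, v = \sum_i c i *: s`_i.
Proof.
by move=> vs; exists (fun i => coord (in_tuple s) i v); exact: (coord_span (X := in_tuple s)).
Qed.

Lemma gram_det_lincomb p vs es (N : 'M[F]_p) : size vs = p -> size es = p ->
  (forall j : 'I_p, vs`_j = \sum_(i < p) N i j *: es`_i) ->
  gram_det vs vs = of_real K (sqnorm (\det N)) * gram_det es es.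
Proof.
move=> vp ep vsE; rewrite /gram_det vp ep sqnormE.
set G := (X in _ = _ * \det X).
rewrite (_ : (\matrix_(i, j) _) = map_mx (sconj R K) N^T *m G *m N).
  by rewrite !det_mulmx det_map_mx det_tr; ring.
apply/matrixP => i j; rewrite !mxE !vsE linear_sum /=; apply: eq_bigr => k _.
rewrite linearZ /= mulrC ip_suml !mxE; congr (_ * _); apply: eq_bigr => l _.
by rewrite ipZl !mxE.
Qed.

Lemma gram_det_dependent s (c : 'I_(size s) -> F) i :
  c i != 0 -> \sum_i c i *: s`_i = 0 -> gram_det s s = 0.
Proof.
move=> ci sc; apply/eqP; rewrite /gram_det -det_tr; apply/det0P.
exists (\row_j c j).
  by apply: contra ci => /eqP/rowP/(_ i); rewrite !mxE => ->.
apply/rowP => j; rewrite !mxE.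
transitivity (ip s`_j (\sum_i c i *: s`_i)); last by rewrite sc linear0.
by rewrite linear_sum; apply: eq_bigr => k _; rewrite !mxE linearZ.
Qed.

Lemma not_free_relation s : ~~ free s ->
  exists (c : 'I_(size s) -> F) i, c i != 0 /\ \sum_i c i *: s`_i = 0.
Proof.
move=> /negP nfs; apply: contrapT => nrel; apply: nfs.
apply: (introT (@freeP _ _ _ (in_tuple s))) => c sc i; apply/eqP/negPn/negP => ci.
by apply: nrel; exists c, i.
Qed.

Lemma orth_complP v W : reflect {in W, forall w, ip w v = 0} (v \in oc W).
Proof. exact: mem_orthovP. Qed.

Definition onb s := forall i j, (i < size s)%N -> (j < size s)%N ->
  ip s`_i s`_j = (i == j)%:R.

Lemma onb_coord s (c : 'I_(size s) -> F) (i : 'I_(size s)) :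
  onb s -> ip s`_i (\sum_j c j *: s`_j) = c i.
Proof.
move=> os; rewrite linear_sum (bigD1 i) //= linearZ /= os // eqxx big1 /=.
  by rewrite mulr1 addr0.
by move=> j ji; rewrite linearZ /= os // val_eqE eq_sym (negbTE ji) mulr0.
Qed.

Lemma onb_gram_det s : onb s -> gram_det s s = 1.
Proof.
move=> os; rewrite -(det1 F (size s)); congr (\det _).
by apply/matrixP => i j; rewrite !mxE os.
Qed.

Lemma onb_free s : onb s -> free s.
Proof.
move=> os; apply: contraT => /not_free_relation[c [i [ci sc]]].
by have := onb_gram_det os; rewrite (gram_det_dependent ci sc) => /eqP; rewrite eq_sym oner_eq0.
Qed.

Lemma onb_span s v : onb s -> v \in << s >>%VS ->
  v = \sum_(i < size s) ip s`_i v *: s`_i.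
Proof.
move=> os /span_lincomb[c vE]; rewrite {1}vE; apply: eq_bigr => i _.
by rewrite vE onb_coord.
Qed.

Lemma onb_residual s v i : onb s -> (i < size s)%N ->
  ip s`_i (v - \sum_(j < size s) ip s`_j v *: s`_j) = 0.
Proof.
move=> os is_; rewrite linearB /=.
by rewrite (onb_coord (fun j => ip s`_j v) (Ordinal is_)) // subrr.
Qed.

Lemma onb_extend1 s U : onb s -> {subset s <= U} -> (size s < \dim U)%N ->
  exists2 w, w \in U & onb (rcons s w).
Proof.
move=> os sU sdim.
have /subvPn[v vU vs] : ~~ (U <= << s >>)%VS.
  by apply: contraL sdim => /dimvS Us; rewrite -leqNgt (leq_trans Us) ?dim_span.
pose p := \sum_(j < size s) ip s`_j v *: s`_j.
have ps : p \in << s >>%VS.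
  by apply: rpred_sum => j _; rewrite rpredZ // memv_span // mem_nth.
have v0 : v - p != 0 by apply: contra vs; rewrite subr_eq0 => /eqP ->.
pose x := real_part (ip (v - p) (v - p)).
have x0 : 0 < x by rewrite real_part_gt0 // ip_gt0.
have vU' : v - p \in U.
  by rewrite rpredB // (subvP (_ : << s >> <= U)%VS) //; exact/span_subvP.
exists (of_real K (Num.sqrt x)^-1 *: (v - p)); first exact: rpredZ.
have orth j : (j < size s)%N -> ip s`_j (v - p) = 0 by exact: onb_residual.
move=> i j; rewrite !size_rcons !ltnS !nth_rcons => ile jle.
have own l : (l < size s)%N -> ip s`_l (of_real K (Num.sqrt x)^-1 *: (v - p)) = 0.
  by move=> jl; rewrite linearZ /= orth // mulr0.
move: ile jle; rewrite leq_eqVlt => /predU1P[->|il];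
    rewrite leq_eqVlt => /predU1P[->|jl].
- rewrite ltnn eqxx ipZl linearZ /= sconj_of_real ip_self -/x -!of_realM.
  rewrite -{3}(sqr_sqrtr (ltW x0)) mulrA -expr2 -exprMn mulVf ?expr1n ?of_real1 //.
  by rewrite sqrtr_eq0 -ltNge.
- by rewrite ltnn eqxx jl gtn_eqF // ip_sym own // rmorph0.
- by rewrite ltnn eqxx il ltn_eqF // own.
by rewrite il jl os.
Qed.

Lemma onb_extend s U k : onb s -> {subset s <= U} -> (size s <= k <= \dim U)%N ->
  exists s', [/\ onb (s ++ s'), {subset s ++ s' <= U} & size (s ++ s') = k].
Proof.
move=> os sU /andP[sk kU]; move: {-1}(k - size s)%N (erefl (k - size s)%N) => m.
elim: m s os sU sk => [|m IH] s os sU sk km.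
  exists [::]; rewrite cats0; split=> //.
  by apply/eqP; rewrite eqn_leq sk -subn_eq0 km.
have [w wU ow] : exists2 w, w \in U & onb (rcons s w).
  by apply: onb_extend1 => //; rewrite (leq_trans _ kU) // -subn_gt0 km.
have [|||s' []] := IH _ ow.
- by move=> v; rewrite mem_rcons inE => /predU1P[->|/sU].
- by rewrite size_rcons -subn_gt0 km.
- by rewrite size_rcons subnS km.
by rewrite cat_rcons => ? ? ?; exists (w :: s').
Qed.

Lemma onb_exists V : exists s, [/\ onb s, << s >>%VS = V & size s = \dim V].
Proof.
have [//|//||s [os sV sdim]] := @onb_extend [::] V (\dim V).
  by rewrite leqnn.
exists s; split=> //; apply/eqP; rewrite eqEdim; apply/andP; split.
  exact/span_subvP.
by have := onb_free os; rewrite /free => /eqP ->; rewrite -sdim.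
Qed.

Lemma onb_cover V k : (\dim V <= k <= \dim {:X})%N ->
  exists s, [/\ onb s, (V <= << s >>)%VS & size s = k].
Proof.
move=> /andP[Vk kX]; have [s [os sV sdim]] := onb_exists V.
have [||s' [os' _ s'k]] := @onb_extend s {:X} k os.
- by move=> v _; exact: memvf.
- by rewrite sdim Vk.
by exists (s ++ s'); split=> //; rewrite span_cat sV addvSl.
Qed.

Lemma orth_decomp W v : exists2 w, w \in W & v - w \in oc W.
Proof.
have [s [os sW _]] := onb_exists W.
exists (\sum_(j < size s) ip s`_j v *: s`_j).
  by rewrite -sW; apply: rpred_sum => j _; rewrite rpredZ // memv_span // mem_nth.
apply/orth_complP => w; rewrite -sW => /span_lincomb[c ->].
by rewrite ip_suml big1 // => i _; rewrite ipZl onb_residual ?mulr0.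
Qed.

Lemma capv_orth_compl W : (W :&: oc W = 0)%VS.
Proof.
apply/eqP; rewrite -subv0; apply/subvP => v; rewrite memv_cap memv0 => /andP[vW].
move=> /orth_complP/(_ _ vW) vv; apply/negPn/negP => /(ip_gt0 dot).
by rewrite vv ltxx.
Qed.

Lemma orth_proj_in W v : orth_proj dot W v \in W.
Proof. exact: memv_pi. Qed.

Lemma orth_proj_eq W v w : w \in W -> v - w \in oc W -> orth_proj dot W v = w.
Proof.
move=> wW vw; rewrite -[v in LHS](subrK w) /orth_proj linearD /=.
rewrite [X in _ + X]daddv_pi_id ?capv_orth_compl //.
have := daddv_pi_add (capv_orth_compl W) (subvP (addvSr W (oc W)) _ vw).
rewrite [X in _ + X]daddv_pi_id ?[(oc W :&: W)%VS]capvC ?capv_orth_compl //.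
by move=> /(canRL (addrK _)) ->; rewrite subrr add0r.
Qed.

Lemma orth_projB W v : v - orth_proj dot W v \in oc W.
Proof. by have [w wW vw] := orth_decomp W v; rewrite (orth_proj_eq wW vw). Qed.

Lemma orth_proj_complB W v : v - orth_proj dot (oc W) v \in W.
Proof.
have [w wW vw] := orth_decomp W v.
rewrite (orth_proj_eq vw) opprB addrC subrK //.
apply/orth_complP => u /orth_complP ou.
by rewrite ip_sym ou ?rmorph0.
Qed.

Lemma orth_proj_linear W : linear (orth_proj dot W).
Proof. exact: linearP. Qed.

HB.instance Definition _ W := GRing.isLinear.Build F X X _ (orth_proj dot W)
  (orth_proj_linear W).

Lemma gram_det_cat vs ws : gram_det (vs ++ ws) (vs ++ ws) =
  gram_det (map (orth_proj dot (oc <<ws>>)) vs) (map (orth_proj dot (oc <<ws>>)) vs)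
    * gram_det ws ws.
Proof.
set P := orth_proj dot _; set m := size vs; set p := size ws.
have /all_sig[c cE] : forall v, {c : 'I_p -> F | v - P v = \sum_i c i *: ws`_i}.
  by move=> v; apply: cid; apply: span_lincomb; exact: orth_proj_complB.
pose C : 'M[F]_(p, m) := \matrix_(i, j) c vs`_j i.
pose N : 'M[F]_(m + p) := block_mx 1%:M 0 C 1%:M.
have sz s t : size s = m -> size t = p -> size (s ++ t) = (m + p)%N :> nat.
  by rewrite size_cat => -> ->.
have nthl s t (i : 'I_m) : size s = m -> (s ++ t)`_(lshift p i) = s`_i.
  by move=> sm; rewrite nth_cat /= sm ltn_ord.
have nthr s t (i : 'I_p) : size s = m -> (s ++ t)`_(rshift m i) = t`_i.
  by move=> sm; rewrite nth_cat /= sm ltnNge leq_addr /= addKn.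
have Pm : size (map P vs) = m by rewrite size_map.
rewrite (@gram_det_lincomb (m + p) (vs ++ ws) (map P vs ++ ws) N) ?sz //.
  rewrite det_lblock !det1 mulr1 sqnorm1 of_real1 mul1r.
  rewrite /gram_det (sz _ _ Pm (erefl p)) Pm.
  rewrite -(det_ublock _ (0 : 'M[F]_(m, p))); congr (\det _).
  have oP v w : w \in <<ws>>%VS -> ip w (P v) = 0.
    by apply/orth_complP; exact: orth_proj_in.
  apply/matrixP => i j; rewrite -(splitK i) -(splitK j).
  case: (fintype.split i) => i'; case: (fintype.split j) => j' /=.
  - by rewrite block_mxEul !mxE !nthl.
  - rewrite block_mxEur !mxE nthl ?nthr // (nth_map 0) // ip_sym oP ?rmorph0 //.
    by rewrite memv_span // mem_nth.
  - rewrite block_mxEdl !mxE nthl ?nthr // (nth_map 0) // oP //.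
    by rewrite memv_span // mem_nth.
  - by rewrite block_mxEdr !mxE !nthr.
move=> j; rewrite big_split_ord /=; rewrite -(splitK j); case: (fintype.split j) => j' /=.
  rewrite nthl // (bigD1 j') //= big1 ?addr0 => [|i ij]; last first.
    by rewrite block_mxEul mxE (negbTE ij) scale0r.
  rewrite block_mxEul mxE eqxx scale1r nthl // (nth_map 0) //.
  rewrite -[LHS](subrK (P vs`_j')) addrC cE; congr (_ + _); apply: eq_bigr => i _.
  by rewrite block_mxEdl mxE nthr.
rewrite nthr // big1 ?add0r => [|i _]; last by rewrite block_mxEur mxE scale0r.
rewrite (bigD1 j') //= big1 ?addr0 => [|i ij]; last first.
  by rewrite block_mxEdr mxE (negbTE ij) scale0r.
by rewrite block_mxEdr mxE eqxx scale1r nthr.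
Qed.

Lemma ip_self_ge0 v : 0 <= real_part (ip v v).
Proof.
have [->|v0] := eqVneq v 0; first by rewrite linear0 raddf0.
by rewrite ltW // real_part_gt0 // ip_gt0.
Qed.

Lemma orth_proj_contraction W v :
  real_part (ip (orth_proj dot W v) (orth_proj dot W v)) <= real_part (ip v v).
Proof.
have : ip (orth_proj dot W v) (v - orth_proj dot W v) = 0.
  by apply/orth_complP; [exact: orth_projB|exact: orth_proj_in].
move: (orth_proj dot W v) => w wd; have dw : ip (v - w) w = 0.
  by rewrite ip_sym wd rmorph0.
move: wd dw; have: v = (v - w) + w by rewrite subrK.
move: (v - w) => u -> wu uw.
by rewrite ipDl !linearD /= wu uw addr0 add0r raddfD /= lerDr ip_self_ge0.
Qed.

Lemma gram_det_hadamard us : exists r, [/\ gram_det us us = of_real K r, 0 <= r &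
  r <= \prod_(u <- us) real_part (ip u u)].
Proof.
have gram1 v : gram_det [:: v] [:: v] = ip v v by rewrite /gram_det det_mx11 mxE.
elim: us => [|u us [r [rE r0 rle]]].
  by exists 1; rewrite big_nil ler01 lexx /gram_det det_mx00 of_real1.
rewrite -cat1s gram_det_cat rE gram1 ip_self -of_realM; set w := orth_proj _ _ u.
exists (real_part (ip w w) * r); split=> //; first by rewrite mulr_ge0 // ip_self_ge0.
by rewrite big_cons ler_pM ?ip_self_ge0 // orth_proj_contraction.
Qed.

Lemma gram_det_map_orth_proj W es gs p (M : 'M[F]_p) vs :
    onb es -> onb gs -> size es = p -> size gs = p -> p = \dim <<vs>> ->
    <<es>>%VS = <<vs>>%VS ->
    (forall j : 'I_p, orth_proj dot W es`_j = \sum_(i < p) M i j *: gs`_i) ->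
  gram_det (map (orth_proj dot W) vs) (map (orth_proj dot W) vs) =
    of_real K (sqnorm (\det M)) * gram_det vs vs.
Proof.
move=> oe og ep gp pE esE ME; set P := orth_proj dot W.
have [fvs|] := boolP (free vs); last first.
  move=> /not_free_relation[c [i [ci vc]]]; rewrite (gram_det_dependent ci vc) mulr0.
  have sP : size vs = size (map P vs) by rewrite size_map.
  apply: (@gram_det_dependent _ (c \o cast_ord (esym sP)) (cast_ord sP i)).
    by rewrite /= cast_ordK.
  transitivity (P (\sum_i c i *: vs`_i)); last by rewrite vc /P linear0.
  rewrite /P linear_sum (reindex (cast_ord sP)) /=; last first.
    by exists (cast_ord (esym sP)) => j _; rewrite ?cast_ordK ?cast_ordKV.
  apply: eq_bigr => j _; rewrite cast_ordK linearZ /= (nth_map 0) //.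
have vp : size vs = p by rewrite pE; apply/esym/eqP.
pose N : 'M[F]_p := \matrix_(i, j) ip es`_i vs`_j.
have vE (j : 'I_p) : vs`_j = \sum_(i < p) N i j *: es`_i.
  have : vs`_j \in <<es>>%VS by rewrite esE memv_span // mem_nth // vp.
  move=> /(onb_span oe) vE; rewrite [LHS]vE ep.
  by apply: eq_bigr => i _; rewrite mxE.
have PvE (j : 'I_p) : (map P vs)`_j = \sum_(i < p) (M *m N) i j *: gs`_i.
  rewrite (nth_map 0) ?vp // vE /P linear_sum.
  under eq_bigr do rewrite linearZ /= ME scaler_sumr.
  rewrite exchange_big; apply: eq_bigr => i _ /=.
  by rewrite mxE scaler_suml; apply: eq_bigr => k _; rewrite scalerA mulrC.
rewrite (gram_det_lincomb _ _ PvE) ?size_map // (gram_det_lincomb vp ep vE).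
by rewrite !onb_gram_det // !mulr1 -of_realM det_mulmx sqnormM.
Qed.

End OrthogonalGeometry.

(** * Volumes and the asymmetric angle *)

Section Volume.
Variables (R : realType) (K : ground) (X : vectType (ground_field R K)).
Variable dot : {dot X for sconj R K}.
Local Notation F := (ground_field R K).
Local Notation ip := (ip dot).
Implicit Types (v w x o : X) (k : nat).

Definition real_gram k (f : k.-tuple X) : 'M[R]_k :=
  \matrix_(i, j) real_part (ip (tnth f i) (tnth f j)).

Lemma real_gram_lincomb k (f u : k.-tuple X) (C : 'M[R]_k) :
  (forall j, tnth u j = \sum_i of_real K (C i j) *: tnth f i) ->
  real_gram u = C^T *m real_gram f *m C.
Proof.
move=> uE; apply/matrixP => i j; rewrite !mxE !uE ip_sumr raddf_sum.
apply: eq_bigr => l _ /=; rewrite ipZr real_partZ mulrC !mxE; congr (_ * _).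
rewrite ip_suml raddf_sum; apply: eq_bigr => m _ /=.
by rewrite ipZl sconj_of_real real_partZ !mxE.
Qed.

Lemma real_gram_orthonormal k (f : k.-tuple X) :
  real_orthonormal dot f -> real_gram f = 1%:M.
Proof. by move=> of_; apply/matrixP => i j; rewrite !mxE of_. Qed.

Definition in_real_span k (f : k.-tuple X) x :=
  exists c : 'I_k -> R, x = \sum_i of_real K (c i) *: tnth f i.

Lemma in_real_span_range k (f : k.-tuple X) x :
  in_real_span f x <-> range (fun t => real_lincomb t f) x.
Proof.
split=> [[c ->]|[t _ <-]]; last by exists (tnth t).
by exists [tuple c i | i < k] => //; apply: eq_bigr => i _; rewrite tnth_mktuple.
Qed.

Lemma in_real_spanB k (f : k.-tuple X) x y :
  in_real_span f x -> in_real_span f y -> in_real_span f (x - y).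
Proof.
move=> [c ->] [d ->]; exists (fun i => c i - d i); rewrite -sumrB.
by apply: eq_bigr => i _; rewrite raddfB /= scalerBl.
Qed.

Lemma in_real_spanD k (f : k.-tuple X) x y :
  in_real_span f x -> in_real_span f y -> in_real_span f (x + y).
Proof.
move=> [c ->] [d ->]; exists (fun i => c i + d i); rewrite -big_split.
by apply: eq_bigr => i _; rewrite raddfD /= scalerDl.
Qed.

Lemma in_real_span_lincomb k l (f : k.-tuple X) (u : l.-tuple X) t :
  (forall i, in_real_span f (tnth u i)) -> in_real_span f (real_lincomb t u).
Proof.
move=> fu; have /all_sig[C CE] : forall j, {c : 'I_k -> R |
    tnth u j = \sum_i of_real K (c i) *: tnth f i} by move=> j; apply: cid; exact: fu.
exists (fun i => \sum_j tnth t j * C j i); rewrite /real_lincomb.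
under eq_bigr do rewrite CE scaler_sumr.
rewrite exchange_big; apply: eq_bigr => i _ /=.
rewrite raddf_sum scaler_suml; apply: eq_bigr => j _.
by rewrite scalerA -of_realM.
Qed.

Lemma real_orthonormal_coord k (f : k.-tuple X) (c : 'I_k -> R) i :
  real_orthonormal dot f ->
  real_part (ip (tnth f i) (\sum_j of_real K (c j) *: tnth f j)) = c i.
Proof.
move=> of_; rewrite ip_sumr raddf_sum (bigD1 i) //= ipZr real_partZ of_.
rewrite eqxx mulr1 big1 ?addr0 // => j ji.
by rewrite ipZr real_partZ of_ eq_sym (negbTE ji) mulr0.
Qed.

Lemma parallelotope_origin k o (u : k.-tuple X) : parallelotope o u o.
Proof.
exists [tuple of nseq k 0]; split=> [i|].
  by rewrite tnth_nseq lexx ler01.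
rewrite /real_lincomb big1 ?addr0 // => i _.
by rewrite tnth_nseq of_real0 scale0r.
Qed.

Lemma parallelotope_edge k o (u : k.-tuple X) i : parallelotope o u (o + tnth u i).
Proof.
exists [tuple (j == i)%:R | j < k]; split=> [j|].
  by rewrite tnth_mktuple; case: eqP; rewrite ?lexx ?ler01.
rewrite /real_lincomb (bigD1 i) //= tnth_mktuple eqxx of_real1 scale1r.
rewrite big1 ?addr0 // => j ji.
by rewrite tnth_mktuple (negbTE ji) of_real0 scale0r.
Qed.

Lemma vol_parallelotope k (f : k.-tuple X) o (u : k.-tuple X) :
  real_orthonormal dot f -> in_real_span f o ->
  (forall i, in_real_span f (tnth u i)) ->
  vol dot k (parallelotope o u) = Num.sqrt (\det (real_gram u)).
Proof.
move=> of_ fo fu; rewrite /vol; set Q := (X in xget _ X).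
have : Q (xget [tuple of nseq k 0] Q).
  apply: xgetPex; exists f; split=> // _ [t [_ ->]]; apply/in_real_span_range.
  by apply: in_real_spanD => //; exact: in_real_span_lincomb.
move: (xget _ Q) => {of_ fo fu}f [of_ fE].
have fS x : parallelotope o u x -> in_real_span f x by move=> /fE/in_real_span_range.
have [b bE] := fS _ (parallelotope_origin o u).
have /all_sig[c cE] : forall j, {c : 'I_k -> R |
    tnth u j = \sum_i of_real K (c i) *: tnth f i}.
  move=> j; apply: cid; rewrite -[tnth u j](addKr o) addrC.
  apply: in_real_spanB; apply: fS; first exact: parallelotope_edge.
  exact: parallelotope_origin.
pose C : 'M[R]_k := \matrix_(i, j) c j i.
have uE j : tnth u j = \sum_i of_real K (C i j) *: tnth f i.
  by rewrite cE; apply: eq_bigr => i _; rewrite mxE.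
have affE s : o + real_lincomb s u = real_lincomb (affine C b s) f.
  rewrite bE /real_lincomb; under [in RHS]eq_bigr do
    rewrite tnth_mktuple raddfD raddf_sum /= scalerDl scaler_suml.
  rewrite big_split /= addrC; congr (_ + _).
  under eq_bigr do rewrite uE scaler_sumr.
  rewrite exchange_big; apply: eq_bigr => i _; apply: eq_bigr => j _ /=.
  by rewrite scalerA mulrC -of_realM.
have finj : injective (fun t => real_lincomb t f).
  move=> s t /(congr1 (fun x => fun i => real_part (ip (tnth f i) x))) /= st.
  apply/eq_from_tnth => i; have := congr1 (@^~ i) st => /=.
  by rewrite !(real_orthonormal_coord (tnth _)).
rewrite (_ : [set t | _] = [set t | exists2 s, @unit_cube R k s & t = affine C b s]).
  rewrite lebesgue_n_affine_cube /= (real_gram_lincomb uE) real_gram_orthonormal //.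
  by rewrite mulmx1 det_mulmx det_tr -expr2 sqrtr_sqr.
apply/seteqP; split => t /=.
  by move=> [s [s01 tE]]; exists s => //; apply: finj; rewrite tE affE.
by move=> [s s01 ->]; exists s; split=> //; rewrite affE.
Qed.

End Volume.

Section Pairing.
Variables m n : nat.

Definition unpair_ord (k : 'I_(m * n)) : 'I_m * 'I_n :=
  enum_val (cast_ord (esym (mxvec_cast m n)) k).

Lemma mxvec_indexK a i : unpair_ord (mxvec_index a i) = (a, i).
Proof. by rewrite /unpair_ord /mxvec_index cast_ordK enum_rankK. Qed.

Lemma unpair_ordK k : mxvec_index (unpair_ord k).1 (unpair_ord k).2 = k.
Proof. by rewrite /unpair_ord /mxvec_index -surjective_pairing enum_valK cast_ordKV. Qed.

Lemma sum_mxvec_index (V : nmodType) (f : 'I_(m * n) -> V) :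
  \sum_k f k = \sum_a \sum_i f (mxvec_index a i).
Proof.
rewrite pair_bigA (reindex (fun ai => mxvec_index ai.1 ai.2)) //=.
exists unpair_ord => [[a i] _|k _]; first exact: mxvec_indexK.
exact: unpair_ordK.
Qed.

End Pairing.

Section Realification.
Variables (R : realType) (K : ground).
Local Notation F := (ground_field R K).
Local Notation d := (real_degree K).

Definition ground_basis : 'I_d -> F :=
  match K return 'I_(real_degree K) -> ground_field R K with
  | Reals => fun _ => 1
  | Complexes => fun a => if a == ord0 then 1 else 'i%C
  end.

Lemma ground_basis_dual a b :
  real_part (sconj R K (ground_basis a) * ground_basis b) = (a == b)%:R.
Proof.
rewrite /ground_basis; case: K a b => /= a b; first by rewrite !ord1 mulr1.
case: a b => [[|[|a]] //= ia] [[|[|b]] //= ib];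
  rewrite ?rmorph1 ?mul1r ?mulr1 //=.
all: by ring.
Qed.

Lemma ground_basis_coord z :
  z = \sum_a of_real K (real_part (sconj R K (ground_basis a) * z)) * ground_basis a.
Proof.
rewrite /ground_basis; case: K z => /= z; first by rewrite big_ord1 mul1r mulr1.
rewrite !big_ord_recl big_ord0 addr0 /= rmorph1 !mul1r mulr1.
case: z => a b /=; apply/eqP; rewrite eq_complex /=.
by apply/andP; split; apply/eqP; ring.
Qed.

(* The matrix over the reals of the map with matrix M over the ground field, in
   the bases of the vectors e_i (and 'i e_i in the complex case). *)
Definition real_matrix p (M : 'M[F]_p) : 'M[R]_(d * p) := \matrix_(k, l)
  real_part (sconj R K (ground_basis (unpair_ord k).1) *
    ground_basis (unpair_ord l).1 * M (unpair_ord k).2 (unpair_ord l).2).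


End Realification.

Lemma det_reindex (F : comRingType) m n (h : 'I_m -> 'I_n) (A : 'M[F]_n) :
  bijective h -> \det (\matrix_(i, j) A (h i) (h j)) = \det A.
Proof.
move=> bh; have mn : m = n by rewrite -(card_ord m) -(card_ord n) (bij_eq_card bh).
subst m; pose s := perm (bij_inj bh).
rewrite (_ : \matrix_(i, j) _ = row_perm s (col_perm s A)).
  rewrite row_permE col_permE !det_mulmx det_perm det_perm.
  rewrite mulrCA -signr_addb odd_permV addbb mulr1 //.
by apply/matrixP => i j; rewrite !mxE !permE.
Qed.

Lemma det_realified_block (C : numClosedFieldType) p (A B : 'M[C]_p) :
  \det (block_mx A (- B) B A) = \det (A + 'i *: B) * \det (A - 'i *: B).
Proof.
(* Conjugation by the unipotent matrix with off-diagonal block 'i. *)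
have -> : block_mx A (- B) B A = block_mx 1%:M (- ('i *: 1%:M)) 0 1%:M *m
    block_mx (A + 'i *: B) 0 B (A - 'i *: B) *m block_mx 1%:M ('i *: 1%:M) 0 1%:M.
  rewrite !mulmx_block !mul1mx !mul0mx !mulmx1 !mulmx0 !add0r !addr0.
  have iN (N : 'M[C]_p) : ('i *: 1%:M) *m N = 'i *: N by rewrite -scalemxAl mul1mx.
  have Ni (N : 'M[C]_p) : N *m ('i *: 1%:M) = 'i *: N by rewrite -scalemxAr mulmx1.
  rewrite !mulNmx !iN !Ni addrK -scalerBr opprB addrCA subrr addr0 scalerA.
  by rewrite -expr2 sqrCi scaleN1r [_ + (A - _)]addrCA subrr addr0.
by rewrite !det_mulmx !det_ublock det_lblock !det1 !mul1r mulr1.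
Qed.

Lemma det_real_matrix (R : realType) (K : ground) p (M : 'M[ground_field R K]_p) :
  `|\det (real_matrix M)| = Num.sqrt (sqnorm (\det M)) ^+ real_degree K.
Proof.
case: K M => M; rewrite /sqnorm /=.
  rewrite expr1 -expr2 sqrtr_sqr; congr `|_|.
  pose h (k : 'I_(1 * p)) := (@unpair_ord 1 p k).2.
  rewrite -(@det_reindex _ _ _ h M); last first.
    exists (@mxvec_index 1 p ord0) => [k|i]; last by rewrite /h mxvec_indexK.
    by rewrite -[RHS](@unpair_ordK 1 p) (ord1 (unpair_ord k).1).
  by congr (\det _); apply/matrixP => k l; rewrite !mxE /= !mul1r.
pose u (k : 'I_(2 * p)) := @unpair_ord 2 p k.
pose h (k : 'I_(2 * p)) : 'I_(p + p) :=
  if (u k).1 == ord0 then lshift p (u k).2 else rshift p (u k).2.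
pose A : 'M[R]_p := map_mx (@complex.Re R) M.
pose B : 'M[R]_p := map_mx (@complex.Im R) M.
have bh : bijective h.
  exists (fun j => match fintype.split j with
    | inl i => @mxvec_index 2 p ord0 i | inr i => @mxvec_index 2 p ord_max i end).
    move=> k; rewrite /h; case: eqP => [u0|/eqP u0].
      by rewrite (unsplitK (inl _)) -u0 (@unpair_ordK 2 p).
    rewrite (unsplitK (inr _)) -[RHS](@unpair_ordK 2 p); congr mxvec_index.
    by case: ((unpair_ord k).1) u0 => -[|[|a]] //= ia _; apply: val_inj.
  move=> j; rewrite -[RHS]splitK; case: (fintype.split j) => i /=;
  by rewrite /h /u mxvec_indexK.
have -> : real_matrix M = \matrix_(k, l) (block_mx A (- B) B A) (h k) (h l).
  apply/matrixP => k l; rewrite [LHS]mxE [RHS]mxE /h /= -/(u k) -/(u l).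
  case: (u k) (u l) => -[[|[|a]] //= ia] i [[[|[|b]] //= ib] j] /=;
  rewrite ?block_mxEul ?block_mxEur ?block_mxEdl ?block_mxEdr !mxE /=;
  case: (M i j) => x y /=; ring.
rewrite det_reindex //.
have toC : injective (fun x : R => x%:C%C) by move=> x y [].
have detE : \det (block_mx A (- B) B A) = sqnorm (K := Complexes) (\det M).
  apply: toC.
  transitivity (sconj R Complexes (\det M) * \det M); last by rewrite -sqnormE.
  rewrite -(det_map_mx (real_complex R)) map_block_mx map_mxN.
  rewrite det_realified_block mulrC; congr (_ * _).
    rewrite /= -det_map_mx; congr (\det _); apply/matrixP => i j; rewrite !mxE.
    case: (M i j) => x y; apply/eqP; rewrite eq_complex /=.
    by apply/andP; split; apply/eqP; ring.
  congr (\det _); apply/matrixP => i j; rewrite !mxE.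
  case: (M i j) => x y; apply/eqP; rewrite eq_complex /=.
  by apply/andP; split; apply/eqP; ring.
rewrite detE ger0_norm ?sqnorm_ge0 // -[LHS](sqr_sqrtr (sqnorm_ge0 _)) //.
Qed.

Section AsymmetricAngle.
Variables (R : realType) (K : ground) (X : vectType (ground_field R K)).
Variable dot : {dot X for sconj R K}.
Local Notation F := (ground_field R K).
Local Notation d := (real_degree K).
Local Notation ip := (ip dot).
Implicit Types (v w o : X) (s es gs vs : seq X) (V W : {vspace X}).

Definition realify p es : (d * p).-tuple X :=
  [tuple ground_basis R (unpair_ord k).1 *: es`_(unpair_ord k).2 | k < d * p].

Lemma tnth_realify p es (a : 'I_d) (i : 'I_p) :
  tnth (realify p es) (mxvec_index a i) = ground_basis R a *: es`_i.
Proof. by rewrite tnth_mktuple mxvec_indexK. Qed.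

Lemma realify_orthonormal p es : onb dot es -> size es = p ->
  real_orthonormal dot (realify p es).
Proof.
move=> oe ep k l; rewrite -(unpair_ordK k) -(unpair_ordK l) !tnth_realify.
case: (unpair_ord k) (unpair_ord l) => a i [b j] /=.
rewrite ipZr ipZl oe ?ep //; set x := ground_basis R a; set y := ground_basis R b.
have -> : y * (sconj R K x * (i == j :> nat)%:R) =
    of_real K (i == j)%:R * (sconj R K x * y) by rewrite rmorph_nat; ring.
rewrite real_partZ ground_basis_dual -natrM mulnb andbC; congr (nat_of_bool _)%:R.
apply/idP/eqP => [/andP[/eqP -> /eqP ->] //|/(congr1 (@unpair_ord _ _))].
by rewrite !mxvec_indexK => -[-> ->]; rewrite !eqxx.
Qed.

Lemma realify_lincomb p es gs (M : 'M[F]_p) :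
    (forall j : 'I_p, es`_j = \sum_(i < p) M i j *: gs`_i) ->
  forall l, tnth (realify p es) l =
    \sum_k of_real K (real_matrix M k l) *: tnth (realify p gs) k.
Proof.
move=> eE l; rewrite -(unpair_ordK l) tnth_realify; case: (unpair_ord l) => b j /=.
rewrite eE scaler_sumr sum_mxvec_index exchange_big /=; apply: eq_bigr => i _.
rewrite scalerA [X in X *: _]ground_basis_coord scaler_suml.
apply: eq_bigr => a _; rewrite tnth_realify scalerA mxE !mxvec_indexK /=.
by rewrite mulrA.
Qed.

Lemma in_real_span_realify p es v : onb dot es -> size es = p ->
  v \in << es >>%VS -> in_real_span (realify p es) v.
Proof.
move=> oe ep /(onb_span oe) vE.
exists (fun k => real_part (sconj R K (ground_basis R (unpair_ord k).1) *
  ip es`_(unpair_ord k).2 v)).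
rewrite {1}vE ep sum_mxvec_index exchange_big /=; apply: eq_bigr => i _.
rewrite [X in X *: _]ground_basis_coord scaler_suml.
by apply: eq_bigr => a _; rewrite tnth_realify scalerA !mxvec_indexK.
Qed.

Lemma mem_realify p es l : size es = p -> tnth (realify p es) l \in << es >>%VS.
Proof.
move=> ep; rewrite -(unpair_ordK l) tnth_realify rpredZ // memv_span // mem_nth //.
by rewrite ep.
Qed.

Lemma orth_proj_real_lincomb W k (t : k.-tuple R) (u : k.-tuple X) :
  orth_proj dot W (real_lincomb t u) =
  real_lincomb t (map_tuple (orth_proj dot W) u).
Proof.
rewrite linear_sum; apply: eq_bigr => i _.
by rewrite tnth_map linearZ.
Qed.

Lemma orth_proj_parallelotope W k o (u : k.-tuple X) :
  [set orth_proj dot W x | x in parallelotope o u] =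
  parallelotope (orth_proj dot W o) (map_tuple (orth_proj dot W) u).
Proof.
apply/seteqP; split => [_ [_ [t [t01 ->]] <-]|_ [t [t01 ->]]].
  by exists t; split=> //; rewrite linearD /= orth_proj_real_lincomb.
exists (o + real_lincomb t u); first by exists t.
by rewrite linearD /= orth_proj_real_lincomb.
Qed.

Section Projection.
Variables (V W : {vspace X}) (es gs : seq X).
Local Notation p := (\dim V).
Hypotheses (oe : onb dot es) (esV : << es >>%VS = V) (ep : size es = p).
Hypotheses (og : onb dot gs) (gp : size gs = p).
Variable M : 'M[F]_p.
Hypothesis ME : forall j : 'I_p, orth_proj dot W es`_j = \sum_(i < p) M i j *: gs`_i.

Let c : R := Num.sqrt (sqnorm (\det M)).

Lemma volume_ratio o (u : (real_dim V).-tuple X) : real_free u ->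
    parallelotope o u `<=` [set` V] ->
  vol dot (real_dim V) [set orth_proj dot W x | x in parallelotope o u] /
    vol dot (real_dim V) (parallelotope o u) = c ^+ d.
Proof.
move=> fu SV; pose P := orth_proj dot W.
have oV : o \in V by exact: (SV _ (parallelotope_origin o u)).
have uV i : tnth u i \in V.
  by rewrite -[tnth u i](addKr o) rpredD ?rpredN //; exact: (SV _ (parallelotope_edge o u i)).
have ore := realify_orthonormal oe ep; have org := realify_orthonormal og gp.
have spanV v : v \in V -> in_real_span (realify p es) v.
  by move=> vV; apply: in_real_span_realify => //; rewrite esV.
have Pes : forall j : 'I_p, (map P es)`_j = \sum_(i < p) M i j *: gs`_i.
  by move=> j; rewrite (nth_map 0) ?ep // ME.
have Pre l : P (tnth (realify p es) l) =
    \sum_k of_real K (real_matrix M k l) *: tnth (realify p gs) k.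
  rewrite -(realify_lincomb Pes) !tnth_mktuple /P linearZ /= (nth_map 0) // ep //.
have spanP v : v \in V -> in_real_span (realify p gs) (P v).
  move=> /spanV[b ->]; rewrite /P linear_sum /=.
  exists (fun k => \sum_l b l * real_matrix M k l).
  under eq_bigr => l _ do rewrite linearZ /= -/(P _) Pre scaler_sumr.
  rewrite exchange_big; apply: eq_bigr => k _ /=.
  rewrite raddf_sum scaler_suml; apply: eq_bigr => l _.
  by rewrite scalerA -of_realM.
have /all_sig[b bE] : forall j, {b : 'I_(d * p) -> R |
    tnth u j = \sum_i of_real K (b i) *: tnth (realify p es) i}.
  by move=> j; apply: cid; apply: spanV.
pose C : 'M[R]_(d * p) := \matrix_(i, j) b j i.
have uE j : tnth u j = \sum_i of_real K (C i j) *: tnth (realify p es) i.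
  by rewrite bE; apply: eq_bigr => i _; rewrite mxE.
have PuE j : tnth (map_tuple P u) j =
    \sum_i of_real K ((real_matrix M *m C) i j) *: tnth (realify p gs) i.
  rewrite tnth_map uE /P linear_sum /=.
  under eq_bigr => l _ do rewrite linearZ /= -/(P _) Pre scaler_sumr.
  rewrite exchange_big; apply: eq_bigr => k _ /=.
  rewrite mxE raddf_sum scaler_suml; apply: eq_bigr => l _.
  by rewrite scalerA mulrC -of_realM.
have C0 : \det C != 0.
  rewrite -det_tr; apply/negP => /det0P[t t0 tC]; move/negP: t0; apply.
  apply/eqP/rowP => i; rewrite mxE.
  have := fu [tuple t ord0 j | j < d * p] _ i; rewrite tnth_mktuple; apply.
  rewrite /real_lincomb; under eq_bigr do rewrite tnth_mktuple uE scaler_sumr.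
  rewrite exchange_big big1 // => k _ /=.
  under eq_bigr do rewrite scalerA -of_realM.
  rewrite -scaler_suml -raddf_sum (_ : \sum_(_ < _) _ = (t *m C^T) ord0 k).
    by rewrite tC mxE raddf0 scale0r.
  by rewrite [RHS]mxE; apply: eq_bigr => j _; rewrite [C^T _ _]mxE.
rewrite orth_proj_parallelotope.
rewrite (vol_parallelotope org (spanP _ oV)); last by move=> i; rewrite tnth_map; exact: spanP.
rewrite (vol_parallelotope ore (spanV _ oV)); last by move=> i; exact: spanV.
rewrite (real_gram_lincomb dot PuE) (real_gram_lincomb dot uE).
rewrite !real_gram_orthonormal // !mulmx1 !det_mulmx !det_tr !det_mulmx -!expr2.
by rewrite !sqrtr_sqr normrM mulfK ?normr_eq0 // det_real_matrix.
Qed.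

Lemma projection_factor_le1 : c <= 1.
Proof.
rewrite /c -sqrtr1 ler_wsqrtr //; pose P := orth_proj dot W.
have := @gram_det_map_orth_proj _ _ _ dot W es gs p M es oe og ep gp.
rewrite esV => /(_ erefl erefl ME); rewrite (onb_gram_det oe) mulr1 => gE.
have [r [rE r0 rle]] := gram_det_hadamard dot (map P es).
rewrite -(of_realK K (sqnorm _)) -gE rE of_realK (le_trans rle) //.
rewrite big_map big_seq prodr_ile1 // => v ves.
rewrite ip_self_ge0 (le_trans (orth_proj_contraction _ _ _)) //.
by rewrite -(nth_index 0 ves) oe ?index_mem // eqxx -(of_real1 R K) of_realK.
Qed.

Lemma is_asym_angle_acos : is_asym_angle dot V W (acos c).
Proof.
have c0 : 0 <= c by exact: sqrtr_ge0.
have c11 : -1 <= c <= 1.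
  by rewrite projection_factor_le1 (le_trans _ c0) // lerN10.
split; last by move=> o u S fu SV; rewrite acosK // volume_ratio.
rewrite acos_ge0 //= leNgt; apply/negP => lt.
have : cos (acos c) < cos (pi / 2).
  rewrite ltr_cos // in_itv /= ?acos_ge0 ?acos_lepi //.
  by rewrite divr_ge0 ?pi_ge0 //= ler_pdivrMr // ler_peMr ?pi_ge0 // ler1n.
by rewrite cos_pihalf acosK // ltNge c0.
Qed.

Lemma cos_asym_angle : cos (asym_angle dot V W) = c.
Proof.
have [/andP[t0 tpi] tE] : is_asym_angle dot V W (asym_angle dot V W).
  by apply: xgetPex; exists (acos c); exact: is_asym_angle_acos.
have ore := realify_orthonormal oe ep.
have fre : real_free (realify p es).
  move=> t tE0 i; rewrite -(real_orthonormal_coord (tnth t) i ore).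
  by rewrite -/(real_lincomb t _) tE0 linear0 raddf0.
have SV : parallelotope 0 (realify p es) `<=` [set` V].
  move=> _ [t [_ ->]]; rewrite /= add0r; apply: rpred_sum => i _.
  by rewrite rpredZ //; move: (mem_realify i ep); rewrite esV.
have := tE 0 _ fre SV; rewrite volume_ratio // => /eqP.
rewrite eqrXn2 ?sqrtr_ge0 //; first by move=> /eqP.
  by case: K.
apply: cos_ge0_pihalf; rewrite tpi andbT; apply: le_trans t0.
by rewrite oppr_le0 divr_ge0 ?pi_ge0.
Qed.

End Projection.

Lemma gram_det_orth_proj W vs : 0 <= cos (asym_angle dot << vs >> W) /\
  gram_det dot (map (orth_proj dot W) vs) (map (orth_proj dot W) vs) =
    of_real K (cos (asym_angle dot << vs >> W) ^+ 2) * gram_det dot vs vs.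
Proof.
set V := << vs >>%VS.
have [es [oe esV ep]] := onb_exists dot V.
(* The image of V may have smaller dimension: gs spans a space of dimension
   \dim V around it, so that the projection has a square matrix. *)
pose U := (daddv_pi W (orth_compl dot W) @: V)%VS.
have [gs [og Ugs gp]] : exists gs, [/\ onb dot gs, (U <= << gs >>)%VS &
    size gs = \dim V].
  apply: onb_cover; apply/andP; split; last by rewrite dimvS ?subvf.
  by rewrite -(limg_ker_dim (daddv_pi W (orth_compl dot W)) V) leq_addl.
pose M : 'M[F]_(\dim V) := \matrix_(i, j) ip gs`_i (orth_proj dot W es`_j).
have ME (j : 'I_(\dim V)) : orth_proj dot W es`_j =
    \sum_(i < \dim V) M i j *: gs`_i.
  have : orth_proj dot W es`_j \in << gs >>%VS.
    apply: (subvP Ugs); apply: memv_img.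
    have : es`_j \in << es >>%VS by rewrite memv_span // mem_nth // ep.
    by rewrite esV.
  move=> /(onb_span og) E; rewrite [LHS]E gp.
  by apply: eq_bigr => i _; rewrite mxE.
rewrite (cos_asym_angle oe esV ep og gp ME) sqr_sqrtr ?sqnorm_ge0 //.
split; first exact: sqrtr_ge0.
exact: (gram_det_map_orth_proj oe og ep gp erefl esV ME).
Qed.

End AsymmetricAngle.

Theorem theoremA2 (R : realType) (K : ground) (X : vectType (ground_field R K))
    (dot : {dot X for sconj R K}) (A B : multivector X) :
  is_blade A -> is_blade B ->
  mv_norm dot (mv_wedge A B) =
    mv_norm dot A * mv_norm dot B *
      cos (compl_angle dot (blade_space A) (blade_space B)).
Proof.
move=> bA bB.
have norm0 : mv_norm dot [ffun => 0] = 0.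
  by rewrite /mv_norm /mv_ip big1 ?raddf0 ?sqrtr0 // => S _;
    rewrite big1 // => T _; rewrite ffunE rmorph0 !mul0r.
have [->|A0] := eqVneq A [ffun => 0].
  rewrite (_ : mv_wedge _ _ = [ffun => 0]) ?norm0 ?mul0r //.
  by apply/ffunP => U; rewrite !ffunE big1 // => S _; rewrite ffunE mulr0 mul0r.
have [->|B0] := eqVneq B [ffun => 0].
  rewrite (_ : mv_wedge _ _ = [ffun => 0]) ?norm0 ?mulr0 ?mul0r //.
  by apply/ffunP => U; rewrite !ffunE big1 // => S _; rewrite ffunE mulr0.
have [k [vs [-> ->]]] := bladeP A0 bA; have [l [ws [-> ->]]] := bladeP B0 bB.
rewrite mv_wedge_scale mv_wedges_cat !mv_norm_scale_wedges /compl_angle.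
have [r [rE r0 _]] := gram_det_hadamard dot vs.
have [s [sE s0 _]] := gram_det_hadamard dot ws.
have [cos0 PE] := gram_det_orth_proj dot (orth_compl dot << ws >>) vs.
set t := asym_angle _ _ _ in cos0 PE *.
rewrite /sqvol gram_det_cat PE rE sE -!of_realM !of_realK.
rewrite -sqrtrM ?mulr_ge0 ?sqnorm_ge0 //.
rewrite -[in RHS](ger0_norm cos0) -sqrtr_sqr -sqrtrM ?mulr_ge0 ?sqnorm_ge0 //.
by congr Num.sqrt; rewrite sqnormM; ring.
Qed.
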